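(* If $\Omega ; \Gamma ; \Delta \vdash P :: x{:}A[\omega]$, then $P$ terminates, i.e. there is no infinite reduction sequence $P \to P_1 \to P_2 \to \cdots$.
   Context: Domain-aware session $\pi$-calculus. Domains $\omega$ range over domain tags $w$ and domain variables $\alpha$. Processes: $P ::= \mathbf 0 \mid P\mid Q \mid (\nu y)P \mid x\langle y\rangle.P \mid x(y).P \mid !x(y).P \mid [x\leftrightarrow y] \mid x\triangleright\{l_i:P_i\}_{i\in I} \mid x\triangleleft l;P \mid x\langle y@\omega\rangle.P \mid x(y@\omega).P \mid x\langle\omega\rangle.P \mid x(\alpha).P$, with $\overline{x}\langle y\rangle.P := (\nu y)x\langle y\rangle.P$, $\overline{x}\langle y@\omega\rangle.P := (\nu y)x\langle y@\omega\rangle.P$. Structural congruence $\equiv$ is the least congruence with $P\mid\mathbf 0\equiv P$, $\alpha$-conversion, $(\nu x)\mathbf 0\equiv\mathbf 0$, $[x\leftrightarrow y]\equiv[y\leftrightarrow x]$, commutativity and associativity of $\mid$, $P\mid(\nu x)Q\equiv(\nu x)(P\mid Q)$ if $x\notin fn(P)$, $(\nu x)(\nu y)P\equiv(\nu y)(\nu x)P$. Reduction $\to$ is closed under $\equiv$, parallel composition and restriction and given by: $x\langle y\rangle.Q\mid x(z).P\to Q\mid P\{y/z\}$; $x\langle y\rangle.Q\mid !x(z).P\to Q\mid P\{y/z\}\mid !x(z).P$; $x\langle y@\omega\rangle.P\mid x(z@\omega').Q\to P\mid Q\{y/z\}$; $x\langle\omega\rangle.P\mid x(\alpha).Q\to P\mid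 Q\{\omega/\alpha\}$; $(\nu x)([x\leftrightarrow y]\mid P)\to P\{y/x\}$; $x\triangleleft l_j;P\mid x\triangleright\{l_i:Q_i\}_{i\in I}\to P\mid Q_j$ ($j\in I$). Session types: $A ::= \mathbf 1 \mid A\multimap B \mid A\otimes B \mid \&\{l_i:A_i\}_{i\in I} \mid \oplus\{l_i:A_i\}_{i\in I} \mid !A \mid @_\omega A \mid \forall\alpha.A \mid \exists\alpha.A \mid {\downarrow}\alpha.A$. An accessibility environment $\Omega$ is a finite set of hypotheses $\omega_1\prec\omega_2$; $\Omega\vdash\omega_1\prec\omega_2$ holds via the rule $\Omega,\omega_1\prec\omega_2\vdash\omega_1\prec\omega_2$; $\prec^*$ is its reflexive transitive closure; $\Omega\vdash\omega\prec^*\Delta$ means $\Omega\vdash\omega\prec^*\omega'$ for all $x{:}A[\omega']\in\Delta$. The judgment $\Omega;\Gamma;\Delta\vdash P::z{:}A[\omega]$ (unrestricted $\Gamma$, linear $\Delta$; typing closed under $\equiv$) is given by the rules: (id) $\Omega;\Gamma;x{:}A[\omega]\vdash[x\leftrightarrow z]::z{:}A[\omega]$. (1R) $\Omega;\Gamma;\cdot\vdash\mathbf 0::z{:}\mathbf 1[\omega]$. (1L) from $\Delta\vdash P::z{:}C[\omega_1]$ infer $\Delta,x{:}\mathbf 1[\omega_2]\vdash P::z{:}C[\omega_1]$. ($\multimap$R) from $\Delta,y{:}A[\omega]\vdash P::z{:}B[\omega]$ infer $\Delta\vdash z(y).P::z{:}A\multimap B[\omega]$. ($\multimap$L) from $\Delta_1\vdash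 P::y{:}A[\omega_2]$ and $\Delta_2,x{:}B[\omega_2]\vdash Q::z{:}C[\omega_1]$ infer $\Delta_1,\Delta_2,x{:}A\multimap B[\omega_2]\vdash\overline{x}\langle y\rangle.(P\mid Q)::z{:}C[\omega_1]$. ($\otimes$R) from $\Delta_1\vdash P::y{:}A[\omega]$, $\Delta_2\vdash Q::z{:}B[\omega]$ infer $\Delta_1,\Delta_2\vdash\overline{z}\langle y\rangle.(P\mid Q)::z{:}A\otimes B[\omega]$. ($\otimes$L) from $\Delta,y{:}A[\omega_2],x{:}B[\omega_2]\vdash P::z{:}C[\omega_1]$ infer $\Delta,x{:}A\otimes B[\omega_2]\vdash x(y).P::z{:}C[\omega_1]$. ($\&$R) from $\Delta\vdash P_i::z{:}A_i[\omega]$ ($i\in I$) infer $\Delta\vdash z\triangleright\{l_i:P_i\}::z{:}\&\{l_i:A_i\}[\omega]$. ($\&$L$_1$) from $\Delta,x{:}A[\omega_2]\vdash P::z{:}C[\omega_1]$ infer $\Delta,x{:}\&\{l_i:A\}[\omega_2]\vdash x\triangleleft l_i;P::z{:}C[\omega_1]$. ($\&$L$_2$) from $\Delta,x{:}\&\{l_i:A_i\}_{i\in I}[\omega_2]\vdash P::z{:}C[\omega_1]$, $k\notin I$, infer the same with $x{:}\&\{l_j:A_j\}_{j\in I\cup\{k\}}[\omega_2]$. ($\oplus$R$_1$) from $\Delta\vdash P::z{:}A[\omega]$ infer $\Delta\vdash z\triangleleft l_i;P::z{:}\oplus\{l_i:A\}[\omega]$. ($\oplus$R$_2$) from $\Delta\vdash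 P::z{:}\oplus\{l_i:A_i\}_{i\in I}[\omega]$, $k\notin I$, infer $\Delta\vdash P::z{:}\oplus\{l_j:A_j\}_{j\in I\cup\{k\}}[\omega]$. ($\oplus$L) from $\Delta,x{:}A_i[\omega_2]\vdash Q_i::z{:}C[\omega_1]$ ($i\in I$) infer $\Delta,x{:}\oplus\{l_i:A_i\}[\omega_2]\vdash x\triangleright\{l_i:Q_i\}::z{:}C[\omega_1]$. (!R) from $\Omega;\Gamma;\cdot\vdash Q::y{:}A[\omega]$ infer $\Omega;\Gamma;\cdot\vdash\overline{z}\langle u\rangle.!u(y).Q::z{:}!A[\omega]$. (!L) from $\Omega;\Gamma,u{:}A[\omega_2];\Delta\vdash P::z{:}C[\omega_1]$ infer $\Omega;\Gamma;\Delta,x{:}!A[\omega_2]\vdash x(u).P::z{:}C[\omega_1]$. (copy) from $\Omega\vdash\omega_1\prec^*\omega_2$ and $\Omega;\Gamma,u{:}A[\omega_2];\Delta,y{:}A[\omega_2]\vdash P::z{:}C[\omega_1]$ infer $\Omega;\Gamma,u{:}A[\omega_2];\Delta\vdash\overline{u}\langle y\rangle.P::z{:}C[\omega_1]$. (cut) from $\Omega\vdash\omega_1\prec^*\omega_2$, $\Omega\vdash\omega_2\prec^*\Delta_1$, $\Omega;\Gamma;\Delta_1\vdash P::x{:}A[\omega_2]$, $\Omega;\Gamma;\Delta_2,x{:}A[\omega_2]\vdash Q::z{:}C[\omega_1]$ infer $\Omega;\Gamma;\Delta_1,\Delta_2\vdash(\nu x)(P\mid Q)::z{:}C[\omega_1]$.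 (cut$^!$) from $\Omega;\Gamma;\cdot\vdash P::x{:}A[\omega_1]$ and $\Omega;\Gamma,u{:}A[\omega_1];\Delta\vdash Q::z{:}C[\omega_2]$ infer $\Omega;\Gamma;\Delta\vdash(\nu u)(!u(x).P\mid Q)::z{:}C[\omega_2]$. (@R) from $\Omega\vdash\omega_1\prec\omega_2$, $\Omega\vdash\omega_2\prec^*\Delta$, $\Omega;\Gamma;\Delta\vdash P::y{:}A[\omega_2]$ infer $\Omega;\Gamma;\Delta\vdash\overline{z}\langle y@\omega_2\rangle.P::z{:}@_{\omega_2}A[\omega_1]$. (@L) from $\Omega,\omega_2\prec\omega_3;\Gamma;\Delta,y{:}A[\omega_3]\vdash P::z{:}C[\omega_1]$ infer $\Omega;\Gamma;\Delta,x{:}@_{\omega_3}A[\omega_2]\vdash x(y@\omega_3).P::z{:}C[\omega_1]$. ($\forall$R) from $\Omega,\omega_1\prec\alpha;\Gamma;\Delta\vdash P::z{:}A[\omega_1]$, $\alpha$ fresh, infer $\Omega;\Gamma;\Delta\vdash z(\alpha).P::z{:}\forall\alpha.A[\omega_1]$. ($\forall$L) from $\Omega\vdash\omega_2\prec\omega_3$ and $\Omega;\Gamma;\Delta,x{:}A\{\omega_3/\alpha\}[\omega_2]\vdash Q::z{:}C[\omega_1]$ infer $\Omega;\Gamma;\Delta,x{:}\forall\alpha.A[\omega_2]\vdash x\langle\omega_3\rangle.Q::z{:}C[\omega_1]$. ($\exists$R) from $\Omega\vdash\omega_1\prec\omega_2$ and $\Omega;\Gamma;\Delta\vdash P::z{:}A\{\omega_2/\alpha\}[\omega_1]$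 infer $\Omega;\Gamma;\Delta\vdash z\langle\omega_2\rangle.P::z{:}\exists\alpha.A[\omega_1]$. ($\exists$L) from $\Omega,\omega_2\prec\alpha;\Gamma;\Delta,x{:}A[\omega_2]\vdash Q::z{:}C[\omega_1]$ infer $\Omega;\Gamma;\Delta,x{:}\exists\alpha.A[\omega_2]\vdash x(\alpha).Q::z{:}C[\omega_1]$. (${\downarrow}$R) from $\Delta\vdash P::z{:}A\{\omega/\alpha\}[\omega]$ infer $\Delta\vdash P::z{:}{\downarrow}\alpha.A[\omega]$. (${\downarrow}$L) from $\Delta,x{:}A\{\omega/\alpha\}[\omega]\vdash P::z{:}C$ infer $\Delta,x{:}{\downarrow}\alpha.A[\omega]\vdash P::z{:}C$. *)

(* Defs.v *)
From Stdlib Require Import List Arith Permutation Relations.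
Import ListNotations.

Definition chan := nat.
Definition label := nat.
Definition dvar := nat.

Inductive dom : Type := DW (w : nat) | DV (a : dvar).

Definition dom_vars (d : dom) : list dvar :=
  match d with DV a => [a] | DW _ => [] end.

(* Processes (named syntax; binders: (nu y), x(y), !x(y), x(y@w), x(alpha)) *)
Inductive proc : Type :=
| PZero
| PPar (P Q : proc)
| PNu (y : chan) (P : proc)
| POut (x y : chan) (P : proc)
| PIn (x y : chan) (P : proc)
| PRep (x y : chan) (P : proc)
| PFwd (x y : chan)
| PCase (x : chan) (bs : list (label * proc))
| PSel (x : chan) (l : label) (P : proc)
| POutAt (x y : chan) (w : dom) (P : proc)
| PInAt (x y : chan) (w : dom) (P : proc)
| POutD (x : chan) (w : dom) (P : proc)
| PInD (x : chan) (a : dvar) (P : proc).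

Fixpoint fn (P : proc) : list chan :=
  match P with
  | PZero => []
  | PPar P Q => fn P ++ fn Q
  | PNu y P => remove Nat.eq_dec y (fn P)
  | POut x y P => x :: y :: fn P
  | PIn x y P => x :: remove Nat.eq_dec y (fn P)
  | PRep x y P => x :: remove Nat.eq_dec y (fn P)
  | PFwd x y => [x; y]
  | PCase x bs => x :: flat_map (fun b => fn (snd b)) bs
  | PSel x _ P => x :: fn P
  | POutAt x y _ P => x :: y :: fn P
  | PInAt x y _ P => x :: remove Nat.eq_dec y (fn P)
  | POutD x _ P => x :: fn P
  | PInD x _ P => x :: fn P
  end.

Fixpoint bn (P : proc) : list chan :=
  match P with
  | PZero => []
  | PPar P Q => bn P ++ bn Q
  | PNu y P => y :: bn P
  | POut _ _ P => bn P
  | PIn _ y P => y :: bn P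
  | PRep _ y P => y :: bn P
  | PFwd _ _ => []
  | PCase _ bs => flat_map (fun b => bn (snd b)) bs
  | PSel _ _ P => bn P
  | POutAt _ _ _ P => bn P
  | PInAt _ y _ P => y :: bn P
  | POutD _ _ P => bn P
  | PInD _ _ P => bn P
  end.

Fixpoint pdfv (P : proc) : list dvar :=
  match P with
  | PZero => []
  | PPar P Q => pdfv P ++ pdfv Q
  | PNu _ P | POut _ _ P | PIn _ _ P | PRep _ _ P | PSel _ _ P => pdfv P
  | PFwd _ _ => []
  | PCase _ bs => flat_map (fun b => pdfv (snd b)) bs
  | POutAt _ _ w P | PInAt _ _ w P | POutD _ w P => dom_vars w ++ pdfv P
  | PInD _ a P => remove Nat.eq_dec a (pdfv P)
  end.

Fixpoint pdbn (P : proc) : list dvar :=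
  match P with
  | PZero => []
  | PPar P Q => pdbn P ++ pdbn Q
  | PNu _ P | POut _ _ P | PIn _ _ P | PRep _ _ P | PSel _ _ P => pdbn P
  | PFwd _ _ => []
  | PCase _ bs => flat_map (fun b => pdbn (snd b)) bs
  | POutAt _ _ _ P | PInAt _ _ _ P | POutD _ _ P => pdbn P
  | PInD _ a P => a :: pdbn P
  end.

Definition rn (y z x : chan) : chan := if Nat.eq_dec x z then y else x.

(* psub y z P : replace the free occurrences of z in P by y (P{y/z}).
   It does not rename binders; it is only used under the side condition
   that y is not a bound name of P, so it is capture-avoiding. *)
Fixpoint psub (y z : chan) (P : proc) : proc :=
  match P with
  | PZero => PZero
  | PPar P Q => PPar (psub y z P) (psub y z Q)
  | PNu v P => if Nat.eq_dec v z then PNu v P else PNu v (psub y z P)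
  | POut x v P => POut (rn y z x) (rn y z v) (psub y z P)
  | PIn x v P => PIn (rn y z x) v (if Nat.eq_dec v z then P else psub y z P)
  | PRep x v P => PRep (rn y z x) v (if Nat.eq_dec v z then P else psub y z P)
  | PFwd x v => PFwd (rn y z x) (rn y z v)
  | PCase x bs => PCase (rn y z x) (map (fun b => (fst b, psub y z (snd b))) bs)
  | PSel x l P => PSel (rn y z x) l (psub y z P)
  | POutAt x v w P => POutAt (rn y z x) (rn y z v) w (psub y z P)
  | PInAt x v w P =>
      PInAt (rn y z x) v w (if Nat.eq_dec v z then P else psub y z P)
  | POutD x w P => POutD (rn y z x) w (psub y z P)
  | PInD x a P => PInD (rn y z x) a (psub y z P)
  end.

Definition dsubd (w : dom) (a : dvar) (d : dom) : dom :=
  match d with DV b => if Nat.eq_dec b a then w else d | DW _ => d end.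

(* dsub w a P : P{w/alpha}, replacing free occurrences of the domain
   variable a; used only when no variable of w is bound in P. *)
Fixpoint dsub (w : dom) (a : dvar) (P : proc) : proc :=
  match P with
  | PZero => PZero
  | PPar P Q => PPar (dsub w a P) (dsub w a Q)
  | PNu v P => PNu v (dsub w a P)
  | POut x v P => POut x v (dsub w a P)
  | PIn x v P => PIn x v (dsub w a P)
  | PRep x v P => PRep x v (dsub w a P)
  | PFwd x v => PFwd x v
  | PCase x bs => PCase x (map (fun b => (fst b, dsub w a (snd b))) bs)
  | PSel x l P => PSel x l (dsub w a P)
  | POutAt x v d P => POutAt x v (dsubd w a d) (dsub w a P)
  | PInAt x v d P => PInAt x v (dsubd w a d) (dsub w a P)
  | POutD x d P => POutD x (dsubd w a d) (dsub w a P)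
  | PInD x b P => if Nat.eq_dec b a then PInD x b P else PInD x b (dsub w a P)
  end.

Inductive scong : proc -> proc -> Prop :=
| sc_refl P : scong P P
| sc_sym P Q : scong P Q -> scong Q P
| sc_trans P Q R : scong P Q -> scong Q R -> scong P R
| sc_par_zero P : scong (PPar P PZero) P
| sc_nu_zero x : scong (PNu x PZero) PZero
| sc_fwd_sym x y : scong (PFwd x y) (PFwd y x)
| sc_par_comm P Q : scong (PPar P Q) (PPar Q P)
| sc_par_assoc P Q R : scong (PPar (PPar P Q) R) (PPar P (PPar Q R))
| sc_scope P Q x : ~ In x (fn P) -> scong (PPar P (PNu x Q)) (PNu x (PPar P Q))
| sc_nu_swap x y P : scong (PNu x (PNu y P)) (PNu y (PNu x P))
| sc_alpha_nu y y' P : ~ In y' (fn P) -> ~ In y' (bn P) ->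
    scong (PNu y P) (PNu y' (psub y' y P))
| sc_alpha_in x y y' P : ~ In y' (fn P) -> ~ In y' (bn P) ->
    scong (PIn x y P) (PIn x y' (psub y' y P))
| sc_alpha_rep x y y' P : ~ In y' (fn P) -> ~ In y' (bn P) ->
    scong (PRep x y P) (PRep x y' (psub y' y P))
| sc_alpha_inat x y y' w P : ~ In y' (fn P) -> ~ In y' (bn P) ->
    scong (PInAt x y w P) (PInAt x y' w (psub y' y P))
| sc_alpha_ind x a a' P : ~ In a' (pdfv P) -> ~ In a' (pdbn P) ->
    scong (PInD x a P) (PInD x a' (dsub (DV a') a P))
| sc_c_par_l P P' Q : scong P P' -> scong (PPar P Q) (PPar P' Q)
| sc_c_par_r P Q Q' : scong Q Q' -> scong (PPar P Q) (PPar P Q')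
| sc_c_nu y P P' : scong P P' -> scong (PNu y P) (PNu y P')
| sc_c_out x y P P' : scong P P' -> scong (POut x y P) (POut x y P')
| sc_c_in x y P P' : scong P P' -> scong (PIn x y P) (PIn x y P')
| sc_c_rep x y P P' : scong P P' -> scong (PRep x y P) (PRep x y P')
| sc_c_case x bs1 l P P' bs2 : scong P P' ->
    scong (PCase x (bs1 ++ (l, P) :: bs2)) (PCase x (bs1 ++ (l, P') :: bs2))
| sc_c_sel x l P P' : scong P P' -> scong (PSel x l P) (PSel x l P')
| sc_c_outat x y w P P' : scong P P' -> scong (POutAt x y w P) (POutAt x y w P')
| sc_c_inat x y w P P' : scong P P' -> scong (PInAt x y w P) (PInAt x y w P')
| sc_c_outd x w P P' : scong P P' -> scong (POutD x w P) (POutD x w P')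
| sc_c_ind x a P P' : scong P P' -> scong (PInD x a P) (PInD x a P').

(* Reduction (substitutions are required to be capture-free; any
   reduct is reachable via alpha-conversion, since reduction is closed
   under structural congruence). *)
Inductive red : proc -> proc -> Prop :=
| r_comm x y z P Q : ~ In y (bn P) ->
    red (PPar (POut x y Q) (PIn x z P)) (PPar Q (psub y z P))
| r_rep x y z P Q : ~ In y (bn P) ->
    red (PPar (POut x y Q) (PRep x z P)) (PPar (PPar Q (psub y z P)) (PRep x z P))
| r_at x y z w w' P Q : ~ In y (bn Q) ->
    red (PPar (POutAt x y w P) (PInAt x z w' Q)) (PPar P (psub y z Q))
| r_dom x w a P Q : (forall b, In b (dom_vars w) -> ~ In b (pdbn Q)) ->
    red (PPar (POutD x w P) (PInD x a Q)) (PPar P (dsub w a Q))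
| r_fwd x y P : ~ In y (bn P) ->
    red (PNu x (PPar (PFwd x y) P)) (psub y x P)
| r_case x l P bs Q : In (l, Q) bs ->
    red (PPar (PSel x l P) (PCase x bs)) (PPar P Q)
| r_par P P' Q : red P P' -> red (PPar P Q) (PPar P' Q)
| r_nu x P P' : red P P' -> red (PNu x P) (PNu x P')
| r_struct P P' Q Q' : scong P P' -> red P' Q' -> scong Q' Q -> red P Q.

Definition terminates (P : proc) : Prop :=
  ~ exists f : nat -> proc, f 0 = P /\ forall n, red (f n) (f (S n)).

(* Session types.  Domain binders (forall, exists, down) are represented
   locally nameless: bound occurrences are de Bruijn indices TDB i. *)
Inductive tdom : Type := TDF (d : dom) | TDB (i : nat).

Inductive ty : Type :=
| TOne
| TLolli (A B : ty)
| TTens (A B : ty)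
| TWith (ts : list (label * ty))
| TPlus (ts : list (label * ty))
| TBang (A : ty)
| TAt (d : tdom) (A : ty)
| TAll (A : ty)
| TEx (A : ty)
| TDown (A : ty).

Definition topen_d (k : nat) (w : dom) (d : tdom) : tdom :=
  match d with TDB i => if Nat.eq_dec i k then TDF w else d | TDF _ => d end.

Fixpoint topen (k : nat) (w : dom) (A : ty) : ty :=
  match A with
  | TOne => TOne
  | TLolli A B => TLolli (topen k w A) (topen k w B)
  | TTens A B => TTens (topen k w A) (topen k w B)
  | TWith ts => TWith (map (fun p => (fst p, topen k w (snd p))) ts)
  | TPlus ts => TPlus (map (fun p => (fst p, topen k w (snd p))) ts)
  | TBang A => TBang (topen k w A)
  | TAt d A => TAt (topen_d k w d) (topen k w A)
  | TAll A => TAll (topen (S k) w A)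
  | TEx A => TEx (topen (S k) w A)
  | TDown A => TDown (topen (S k) w A)
  end.

Definition tinst (A : ty) (w : dom) : ty := topen 0 w A.

Fixpoint tdvars (A : ty) : list dvar :=
  match A with
  | TOne => []
  | TLolli A B | TTens A B => tdvars A ++ tdvars B
  | TWith ts | TPlus ts => flat_map (fun p => tdvars (snd p)) ts
  | TBang A | TAll A | TEx A | TDown A => tdvars A
  | TAt (TDF d) A => dom_vars d ++ tdvars A
  | TAt (TDB _) A => tdvars A
  end.

Definition ctx := list (chan * ty * dom).
Definition names (G : ctx) : list chan := map (fun e => fst (fst e)) G.
Definition ctx_dvars (G : ctx) : list dvar :=
  flat_map (fun e => tdvars (snd (fst e)) ++ dom_vars (snd e)) G.

(* accessibility environment Omega : set of hypotheses w1 < w2 *)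
Definition accenv := list (dom * dom).
Definition om_dvars (Om : accenv) : list dvar :=
  flat_map (fun p => dom_vars (fst p) ++ dom_vars (snd p)) Om.

Definition acc (Om : accenv) (w1 w2 : dom) : Prop := In (w1, w2) Om.
Definition accs (Om : accenv) : dom -> dom -> Prop := clos_refl_trans dom (acc Om).
Definition accs_ctx (Om : accenv) (w : dom) (D : ctx) : Prop :=
  Forall (fun e => accs Om w (snd e)) D.

(* standard convention: the names of Gamma, Delta and z are pairwise distinct *)
Definition wf (G D : ctx) (z : chan) : Prop := NoDup (z :: names (G ++ D)).
Definition freshc (y : chan) (G D : ctx) (z : chan) : Prop := ~ In y (z :: names (G ++ D)).

Inductive typed : accenv -> ctx -> ctx -> proc -> chan -> ty -> dom -> Prop :=
| t_id Om G x z A w :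
    wf G [(x, A, w)] z ->
    typed Om G [(x, A, w)] (PFwd x z) z A w
| t_oneR Om G z w :
    wf G [] z ->
    typed Om G [] PZero z TOne w
| t_oneL Om G D x P z C w1 w2 :
    wf G (D ++ [(x, TOne, w2)]) z ->
    typed Om G D P z C w1 ->
    typed Om G (D ++ [(x, TOne, w2)]) P z C w1
| t_lolliR Om G D y P z A B w :
    wf G D z ->
    typed Om G (D ++ [(y, A, w)]) P z B w ->
    typed Om G D (PIn z y P) z (TLolli A B) w
| t_lolliL Om G D1 D2 x y P Q z A B C w1 w2 :
    wf G (D1 ++ D2 ++ [(x, TLolli A B, w2)]) z ->
    freshc y G (D1 ++ D2 ++ [(x, TLolli A B, w2)]) z ->
    typed Om G D1 P y A w2 ->
    typed Om G (D2 ++ [(x, B, w2)]) Q z C w1 ->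
    typed Om G (D1 ++ D2 ++ [(x, TLolli A B, w2)])
      (PNu y (POut x y (PPar P Q))) z C w1
| t_tensR Om G D1 D2 y P Q z A B w :
    wf G (D1 ++ D2) z ->
    freshc y G (D1 ++ D2) z ->
    typed Om G D1 P y A w ->
    typed Om G D2 Q z B w ->
    typed Om G (D1 ++ D2) (PNu y (POut z y (PPar P Q))) z (TTens A B) w
| t_tensL Om G D x y P z A B C w1 w2 :
    wf G (D ++ [(x, TTens A B, w2)]) z ->
    typed Om G (D ++ [(y, A, w2); (x, B, w2)]) P z C w1 ->
    typed Om G (D ++ [(x, TTens A B, w2)]) (PIn x y P) z C w1
| t_withR Om G D z bs ts w :
    wf G D z ->
    NoDup (map fst bs) -> NoDup (map fst ts) ->
    Permutation (map fst bs) (map fst ts) ->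
    (forall l P A, In (l, P) bs -> In (l, A) ts -> typed Om G D P z A w) ->
    typed Om G D (PCase z bs) z (TWith ts) w
| t_withL1 Om G D x l A P z C w1 w2 :
    wf G (D ++ [(x, TWith [(l, A)], w2)]) z ->
    typed Om G (D ++ [(x, A, w2)]) P z C w1 ->
    typed Om G (D ++ [(x, TWith [(l, A)], w2)]) (PSel x l P) z C w1
| t_withL2 Om G D x ts ts' k Ak P z C w1 w2 :
    wf G (D ++ [(x, TWith ts', w2)]) z ->
    ~ In k (map fst ts) ->
    Permutation ts' ((k, Ak) :: ts) ->
    typed Om G (D ++ [(x, TWith ts, w2)]) P z C w1 ->
    typed Om G (D ++ [(x, TWith ts', w2)]) P z C w1
| t_plusR1 Om G D l P z A w :
    wf G D z ->
    typed Om G D P z A w ->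
    typed Om G D (PSel z l P) z (TPlus [(l, A)]) w
| t_plusR2 Om G D ts ts' k Ak P z w :
    wf G D z ->
    ~ In k (map fst ts) ->
    Permutation ts' ((k, Ak) :: ts) ->
    typed Om G D P z (TPlus ts) w ->
    typed Om G D P z (TPlus ts') w
| t_plusL Om G D x bs ts z C w1 w2 :
    wf G (D ++ [(x, TPlus ts, w2)]) z ->
    NoDup (map fst bs) -> NoDup (map fst ts) ->
    Permutation (map fst bs) (map fst ts) ->
    (forall l Q A, In (l, Q) bs -> In (l, A) ts ->
        typed Om G (D ++ [(x, A, w2)]) Q z C w1) ->
    typed Om G (D ++ [(x, TPlus ts, w2)]) (PCase x bs) z C w1
| t_bangR Om G u y Q z A w :
    wf G [] z ->
    ~ In u (z :: y :: names G) ->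
    typed Om G [] Q y A w ->
    typed Om G [] (PNu u (POut z u (PRep u y Q))) z (TBang A) w
| t_bangL Om G D x u P z A C w1 w2 :
    wf G (D ++ [(x, TBang A, w2)]) z ->
    u <> x ->
    typed Om (G ++ [(u, A, w2)]) D P z C w1 ->
    typed Om G (D ++ [(x, TBang A, w2)]) (PIn x u P) z C w1
| t_copy Om G D u y P z A C w1 w2 :
    wf (G ++ [(u, A, w2)]) D z ->
    accs Om w1 w2 ->
    typed Om (G ++ [(u, A, w2)]) (D ++ [(y, A, w2)]) P z C w1 ->
    typed Om (G ++ [(u, A, w2)]) D (PNu y (POut u y P)) z C w1
| t_cut Om G D1 D2 x P Q z A C w1 w2 :
    wf G (D1 ++ D2) z ->
    accs Om w1 w2 ->
    accs_ctx Om w2 D1 ->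
    typed Om G D1 P x A w2 ->
    typed Om G (D2 ++ [(x, A, w2)]) Q z C w1 ->
    typed Om G (D1 ++ D2) (PNu x (PPar P Q)) z C w1
| t_cutbang Om G D u x P Q z A C w1 w2 :
    wf G D z ->
    x <> u ->
    typed Om G [] P x A w1 ->
    typed Om (G ++ [(u, A, w1)]) D Q z C w2 ->
    typed Om G D (PNu u (PPar (PRep u x P) Q)) z C w2
| t_atR Om G D y P z A w1 w2 :
    wf G D z ->
    y <> z ->
    acc Om w1 w2 ->
    accs_ctx Om w2 D ->
    typed Om G D P y A w2 ->
    typed Om G D (PNu y (POutAt z y w2 P)) z (TAt (TDF w2) A) w1
| t_atL Om G D x y P z A C w1 w2 w3 :
    wf G (D ++ [(x, TAt (TDF w3) A, w2)]) z ->
    y <> x ->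
    typed ((w2, w3) :: Om) G (D ++ [(y, A, w3)]) P z C w1 ->
    typed Om G (D ++ [(x, TAt (TDF w3) A, w2)]) (PInAt x y w3 P) z C w1
| t_allR Om G D a P z A w1 :
    wf G D z ->
    ~ In a (om_dvars Om ++ ctx_dvars G ++ ctx_dvars D ++ tdvars A ++ dom_vars w1) ->
    typed ((w1, DV a) :: Om) G D P z (tinst A (DV a)) w1 ->
    typed Om G D (PInD z a P) z (TAll A) w1
| t_allL Om G D x Q z A C w1 w2 w3 :
    wf G (D ++ [(x, TAll A, w2)]) z ->
    acc Om w2 w3 ->
    typed Om G (D ++ [(x, tinst A w3, w2)]) Q z C w1 ->
    typed Om G (D ++ [(x, TAll A, w2)]) (POutD x w3 Q) z C w1
| t_exR Om G D P z A w1 w2 :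
    wf G D z ->
    acc Om w1 w2 ->
    typed Om G D P z (tinst A w2) w1 ->
    typed Om G D (POutD z w2 P) z (TEx A) w1
| t_exL Om G D x a Q z A C w1 w2 :
    wf G (D ++ [(x, TEx A, w2)]) z ->
    ~ In a (om_dvars Om ++ ctx_dvars G ++ ctx_dvars D ++ tdvars A ++ tdvars C
            ++ dom_vars w1 ++ dom_vars w2) ->
    typed ((w2, DV a) :: Om) G (D ++ [(x, tinst A (DV a), w2)]) Q z C w1 ->
    typed Om G (D ++ [(x, TEx A, w2)]) (PInD x a Q) z C w1
| t_downR Om G D P z A w :
    wf G D z ->
    typed Om G D P z (tinst A w) w ->
    typed Om G D P z (TDown A) w
| t_downL Om G D x P z A C w w1 :
    wf G (D ++ [(x, TDown A, w)]) z ->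
    typed Om G (D ++ [(x, tinst A w, w)]) P z C w1 ->
    typed Om G (D ++ [(x, TDown A, w)]) P z C w1
| t_perm Om G G' D D' P z A w :
    Permutation G G' -> Permutation D D' ->
    typed Om G D P z A w -> typed Om G' D' P z A w
| t_cong Om G D P Q z A w :
    scong P Q -> typed Om G D Q z A w -> typed Om G D P z A w.

(* Main.v *)
Require Import Defs.
From Stdlib Require Import List Arith Lia Permutation.
From Stdlib Require Import FunctionalExtensionality PropExtensionality.
Import ListNotations.

(** Only the replicated rule duplicates anything, so it suffices to bound in advance the number of
    copies of each server that will be spawned.  This is done with a relational (non-idempotent)
    semantics.  A channel carries points recording one concrete use of it, and [qt P T n] says that
    [P], with every server replaced by finitely many copies, has a linear approximant of size [n]
    using the resources [T].  This relation is invariant under structural congruence, and a reduction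
    between coherent resources consumes part of the approximant, so that [n] decreases; hence every
    process with a coherent [qt] terminates.  Domains play no role.

    That typed processes have a [qt] is a totality argument: every session type is interpreted as a
    family of sets of points, and every typing rule, including congruence, maps total sets to total
    sets.  No inversion or subject reduction for the typing judgment itself is needed. *)

(** Typing is closed under [scong], and several rules leave no trace in the process, so a derivation
    need not follow the shape of its process; this is why [qt] interprets bare processes. A point
    stands for one use, so parallel composition splits the resources and sizes simply add up. How
    many copies of a server are needed is decided by its clients: a total set at [TBang A] therefore
    answers every finite list of calls, and the finite list made by an approximant of the client
    fixes the copies.

    Totality at [TLolli] quantifies over the total sets of the argument, yet recursion on the type
    suffices: types are not recursive, and quantifiers instantiate only domains, which [tot]
    ignores.

    The free channels of an open process have no provider. [PDag] is a total answer at every type,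
    so each free channel can be answered by [PDag] alone. A session prefix waiting on such a linear
    channel has size 0 and may itself answer [PDag]; this keeps the argument compositional without
    first closing the process. *)

(* [PCom cs k]: a name used by its receiver at the points [cs] is exchanged, then the channel goes
   on as [k].  [PCall a]: a server is invoked and its copy used at [a].  [PDag]: the provider never
   answers. *)
Inductive pt : Type :=
| PNil
| PDag
| PCom (cs : list pt) (k : pt)
| PCall (a : pt)
| PLab (l : label) (k : pt).

(* A provider [EP M] offers the multiset [M]; each client [EM a] consumes one element of it. *)
Inductive ent : Type := EP (M : list pt) | EM (a : pt).

Fixpoint pt_dec (a b : pt) {struct a} : {a = b} + {a <> b}.
Proof. decide equality; [apply (list_eq_dec pt_dec) | apply Nat.eq_dec]. Qed.

Definition ent_dec (e e' : ent) : {e = e'} + {e <> e'}.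
Proof. decide equality; [apply (list_eq_dec pt_dec) | apply pt_dec]. Qed.

(** * Resource environments and linear approximants *)

Definition env := chan -> ent -> nat.

Definition eadd (T T' : env) : env := fun v e => T v e + T' v e.
Definition ele (T T' : env) : Prop := forall v e, T v e <= T' v e.
Definition unit_ent (e : ent) : ent -> nat := fun e' => if ent_dec e' e then 1 else 0.
Definition at_chan (x : chan) (U : ent -> nat) : env :=
  fun v e => if Nat.eq_dec v x then U e else 0.
Definition one (x : chan) (e : ent) : env := at_chan x (unit_ent e).
Definition clients (cs : list pt) : ent -> nat :=
  fun e => match e with EM a => count_occ pt_dec cs a | EP _ => 0 end.
Definition cl (y : chan) (cs : list pt) : env := at_chan y (clients cs).
(** Both ends of a linear channel carry the same point and differ only in side, so coherence of the
    two ends is equality of points. *)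
Definition side (s : bool) (a : pt) : ent := if s then EP [a] else EM a.

Definition shareable (M : list pt) : Prop :=
  length M <= 1 \/ forall a, In a M -> exists b, a = PCall b.

(* At most one provider, whose offer covers all clients; if there is no provider, [M] is arbitrary,
   but at most one client may use a linear channel. *)
Definition valid (U : ent -> nat) : Prop :=
  exists M, shareable M /\ (forall a, U (EM a) <= count_occ pt_dec M a) /\
    (forall M', U (EP M') <= unit_ent (EP M) (EP M')).

Definition quant := env -> nat -> Prop.

Definition kpar (K1 K2 : quant) : quant := fun T n =>
  exists T1 n1 T2 n2, K1 T1 n1 /\ K2 T2 n2 /\ ele (eadd T1 T2) T /\ n = n1 + n2.

Definition under (y : chan) (T' T : env) : Prop :=
  forall v e, v <> y -> T' v e <= T v e.

(** [B] is coherence for a restriction, and for an input it is a bound promised by the communicated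
    point. *)
Definition kbind (y : chan) (B : (ent -> nat) -> Prop) (K : quant) : quant := fun T n =>
  exists T', K T' n /\ B (T' y) /\ under y T' T.

Definition kdom (K : quant) : quant := fun T n =>
  exists T' m, K T' m /\ ele T' T /\ n = S m.

(* In the first case the thread waits forever, and its continuation needs no resources. *)
Definition kact (x : chan) (J : pt -> pt -> quant) : quant := fun T n =>
  (n = 0 /\ 1 <= T x (EM PDag)) \/
  exists s a k T0 T1 m, J a k T1 m /\ ele T1 (eadd T0 (one x (side s k))) /\
    ele (eadd T0 (one x (side s a))) T /\ n = S m.

(** The sender pays for the receiver: the uses [cs] that the receiver will make of the name are
    charged to [y] here, and [jin] stays within them. *)
Definition jout (y : chan) (K : quant) (a k : pt) : quant := fun T m =>
  exists cs T', a = PCom cs k /\ K T' m /\ ele (eadd T' (cl y cs)) T.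

Definition atmost (V : ent -> nat) (U : ent -> nat) : Prop := forall e, U e <= V e.

Definition jin (y : chan) (K : quant) (a k : pt) : quant := fun T m =>
  exists cs, a = PCom cs k /\ kbind y (atmost (clients cs)) K T m.

Definition jsel (l : label) (K : quant) (a k : pt) : quant := fun T m =>
  a = PLab l k /\ exists T', K T' m /\ ele T' T.

(** Only branches labelled [l] need an approximant; a label absent from [bs] imposes nothing. *)
Definition jcase (bs : list (label * quant)) (a k : pt) : quant := fun T m =>
  exists l, a = PLab l k /\ forall K, In (l, K) bs -> exists T', K T' m /\ ele T' T.

(** A call reverses the roles on the transmitted name: the server copy provides [y], whereas the
    receiver of a session output uses it as a client. An output prefix does not show which of the
    two it is, hence the disjunction in [qt]. *)
Definition kcall (x y : chan) (K : quant) : quant := fun T n =>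
  exists a T' m, K T' m /\
    ele (eadd T' (eadd (one x (EM (PCall a))) (one y (EP [a])))) T /\ n = S m.

Fixpoint copies (R : pt -> quant) (aa : list pt) (T : env) (n : nat) : Prop :=
  match aa with
  | [] => n = 0
  | a :: aa' => exists T1 n1 T2 n2, R a T1 n1 /\ copies R aa' T2 n2 /\
                 ele (eadd T1 T2) T /\ n = n1 + n2
  end.

Definition krep (x y : chan) (K : quant) : quant := fun T n =>
  exists aa T0, copies (fun a => kbind y (atmost (unit_ent (EP [a]))) K) aa T0 n /\
    ele (eadd T0 (one x (EP (map PCall aa)))) T.

Definition is_call (a : pt) : Prop := exists b, a = PCall b.

(** Call points are excluded because a shared channel may have several clients, of which a forwarder
    could account for only one. The size 1 pays for its removal. *)
Definition kfwd (x y : chan) : quant := fun T n =>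
  exists s a, ~ is_call a /\
    ele (eadd (one x (side s a)) (one y (side (negb s) a))) T /\ n = 1.

(* Domains are ignored: a domain prefix only contributes to the size. *)
Fixpoint qt (P : proc) : quant :=
  match P with
  | PZero => fun _ n => n = 0
  | PPar P Q => kpar (qt P) (qt Q)
  | PNu y P => kbind y valid (qt P)
  | POut x y P => fun T n => kact x (jout y (qt P)) T n \/ kcall x y (qt P) T n
  | PIn x y P => kact x (jin y (qt P))
  | PRep x y P => krep x y (qt P)
  | PFwd x y => kfwd x y
  | PCase x bs => kact x (jcase (map (fun b => (fst b, qt (snd b))) bs))
  | PSel x l P => kact x (jsel l (qt P))
  | POutAt x y _ P => kact x (jout y (qt P))
  | PInAt x y _ P => kact x (jin y (qt P))
  | POutD _ _ P => kdom (qt P)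
  | PInD _ _ P => kdom (qt P)
  end.

(* The automatically generated principle has no hypothesis for the branches of [PCase]. *)
Lemma proc_nested_ind (R : proc -> Prop) :
  R PZero ->
  (forall P Q, R P -> R Q -> R (PPar P Q)) ->
  (forall y P, R P -> R (PNu y P)) ->
  (forall x y P, R P -> R (POut x y P)) ->
  (forall x y P, R P -> R (PIn x y P)) ->
  (forall x y P, R P -> R (PRep x y P)) ->
  (forall x y, R (PFwd x y)) ->
  (forall x bs, (forall l P, In (l, P) bs -> R P) -> R (PCase x bs)) ->
  (forall x l P, R P -> R (PSel x l P)) ->
  (forall x y w P, R P -> R (POutAt x y w P)) ->
  (forall x y w P, R P -> R (PInAt x y w P)) ->
  (forall x w P, R P -> R (POutD x w P)) ->
  (forall x a P, R P -> R (PInD x a P)) ->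
  forall P, R P.
Proof.
  intros H0 H1 H2 H3 H4 H5 H6 H7 H8 H9 H10 H11 H12.
  fix IH 1. intros P; destruct P;
    [apply H0 | apply H1 | apply H2 | apply H3 | apply H4 | apply H5 | apply H6 | apply H7
    | apply H8 | apply H9 | apply H10 | apply H11 | apply H12]; try apply IH.
  induction bs as [|[l P] bs IHbs]; simpl; [tauto|].
  intros l' P' [E|E]; [injection E as <- <-; apply IH | exact (IHbs _ _ E)].
Qed.

(** * Environments *)

Ltac env_simp :=
  unfold eadd, one, cl, at_chan in *;
  repeat match goal with
  | H : context [if Nat.eq_dec ?a ?b then _ else _] |- _ =>
      destruct (Nat.eq_dec a b); subst; try congruence
  | |- context [if Nat.eq_dec ?a ?b then _ else _] =>
      destruct (Nat.eq_dec a b); subst; try congruence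
  end.

Ltac spec v e :=
  repeat match goal with
  | H : ele _ _ |- _ => let H' := fresh in pose proof (H v e) as H'; clear H; rename H' into H; unfold eadd in H
  | H : under _ _ _ |- _ => let H' := fresh in pose proof (H v e) as H'; clear H; rename H' into H
  end.

Ltac ele_tac :=
  let v := fresh "v" in let e := fresh "e" in
  intros v e; spec v e; unfold eadd in *; try lia.

Lemma ele_refl T : ele T T.
Proof. intros v e; lia. Qed.

Lemma ele_trans T1 T2 T3 : ele T1 T2 -> ele T2 T3 -> ele T1 T3.
Proof. intros H1 H2; ele_tac. Qed.

Lemma valid_le U U' : valid U -> (forall e, U' e <= U e) -> valid U'.
Proof.
  intros (M & HM & H1 & H2) H. exists M; repeat split; auto.
  - intros a; specialize (H (EM a)); specialize (H1 a); lia.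
  - intros M'; specialize (H (EP M')); specialize (H2 M'); lia.
Qed.

Lemma one_le x e T : 1 <= T x e <-> ele (one x e) T.
Proof.
  split; intros H.
  - intros v e'. unfold one, at_chan, unit_ent.
    destruct (Nat.eq_dec v x), (ent_dec e' e); subst; lia.
  - specialize (H x e). unfold one, at_chan, unit_ent in H.
    destruct (Nat.eq_dec x x), (ent_dec e e); congruence || lia.
Qed.

Lemma kact_mono x J T T' n : kact x J T n -> ele T T' -> kact x J T' n.
Proof.
  intros [[E H]|(s & a & k & T0 & T1 & m & HJ & H1 & H2 & E)] Hle.
  - left; split; auto. specialize (Hle x (EM PDag)); lia.
  - right; exists s, a, k, T0, T1, m; repeat split; eauto using ele_trans.
Qed.

Lemma kbind_mono y B K T T' n : kbind y B K T n -> ele T T' -> kbind y B K T' n.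
Proof.
  intros (T1 & HK & HB & Hu) Hle. exists T1; repeat split; auto.
  intros v e Hv. specialize (Hu v e Hv); specialize (Hle v e); lia.
Qed.

Lemma qt_mono P T T' n : qt P T n -> ele T T' -> qt P T' n.
Proof.
  destruct P; simpl; intros H Hle; auto; try (eapply kact_mono; eassumption).
  - destruct H as (T1 & n1 & T2 & n2 & ? & ? & ? & ?).
    exists T1, n1, T2, n2; eauto using ele_trans.
  - eapply kbind_mono; eassumption.
  - destruct H as [H|(a & T1 & m & ? & ? & ?)];
      [left; eapply kact_mono; eassumption | right; exists a, T1, m; eauto using ele_trans].
  - destruct H as (aa & T0 & ? & ?); exists aa, T0; eauto using ele_trans.
  - destruct H as (s & a & ? & ? & ?); exists s, a; eauto using ele_trans.
  - destruct H as (T1 & m & ? & ? & ?); exists T1, m; eauto using ele_trans.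
  - destruct H as (T1 & m & ? & ? & ?); exists T1, m; eauto using ele_trans.
Qed.

(** * Renaming *)

(** Erasing, renaming and undoing a renaming are all monotone and additive on resources; this is
    enough to transport each connective once for all three. *)
Record emap (f : env -> env) : Prop := {
  emap_le : forall T T', ele T T' -> ele (f T) (f T');
  emap_add : forall T T' v e, f (eadd T T') v e = f T v e + f T' v e }.

Definition clr (x : chan) (T : env) : env :=
  fun v e => if Nat.eq_dec v x then 0 else T v e.

Definition ren (y z : chan) (T : env) : env := fun v e =>
  if Nat.eq_dec y z then T v e
  else if Nat.eq_dec v y then T y e + T z e
  else if Nat.eq_dec v z then 0 else T v e.

(** Undoes [ren y z]. Whatever [T] holds at [z] is dropped: for distinct names, [z] is no longer
    free after the substitution. *)
Definition pull (y z : chan) (T : env) : env :=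
  fun v e => if Nat.eq_dec v y then 0 else T (rn y z v) e.

Lemma emap_clr x : emap (clr x).
Proof.
  split; [intros T T' H v e; spec v e | intros T T' v e]; unfold clr, eadd;
    destruct (Nat.eq_dec v x); lia.
Qed.

Lemma emap_ren y z : emap (ren y z).
Proof.
  split; [intros T T' H v e | intros T T' v e]; unfold ren, eadd;
    [pose proof (H v e); pose proof (H y e); pose proof (H z e)|];
    repeat destruct Nat.eq_dec; lia.
Qed.

Lemma emap_pull y z : emap (pull y z).
Proof.
  split; [intros T T' H v e; pose proof (H (rn y z v) e) | intros T T' v e]; unfold pull, eadd;
    destruct (Nat.eq_dec v y); lia.
Qed.

Definition emaps (f : env -> env) (x x' : chan) : Prop :=
  forall U v e, f (at_chan x U) v e = at_chan x' U v e.

Lemma emaps_clr x y : x <> y -> emaps (clr y) x x.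
Proof. intros H U v e. unfold clr; env_simp; auto. Qed.

Lemma emaps_ren y z x : emaps (ren y z) x (rn y z x).
Proof. intros U v e. unfold ren, rn. env_simp; auto; lia. Qed.

Lemma emaps_pull y z x : x <> y -> emaps (pull y z) (rn y z x) x.
Proof. intros H U v e. unfold pull, rn. env_simp; auto. Qed.

Section Emap.
Context (f : env -> env) (Hf : emap f).

Lemma emap_sum T1 T2 T : ele (eadd T1 T2) T -> ele (eadd (f T1) (f T2)) (f T).
Proof.
  intros H v e. unfold eadd at 1. rewrite <- (emap_add f Hf). now apply (emap_le f Hf).
Qed.

Lemma emap_sum_r T1 T2 T : ele T (eadd T1 T2) -> ele (f T) (eadd (f T1) (f T2)).
Proof.
  intros H v e. unfold eadd at 1. rewrite <- (emap_add f Hf). now apply (emap_le f Hf).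
Qed.

Lemma kact_emap x x' J J' T n :
  emaps f x x' -> (forall a k T m, J a k T m -> J' a k (f T) m) ->
  kact x J T n -> kact x' J' (f T) n.
Proof.
  intros Hx HJ [[E H]|(s & a & k & T0 & T1 & m & H & H1 & H2 & E)].
  - left; split; auto. apply one_le in H. apply one_le.
    apply (emap_le f Hf) in H. intros v e. specialize (H v e).
    unfold one in *. now rewrite Hx in H.
  - right; exists s, a, k, (f T0), (f T1), m; repeat split; auto.
    + apply emap_sum_r in H1. intros v e. specialize (H1 v e). unfold eadd, one in *.
      now rewrite Hx in H1.
    + apply emap_sum in H2. intros v e. specialize (H2 v e). unfold eadd, one in *.
      now rewrite Hx in H2.
Qed.

Lemma jout_emap y y' (K K' : quant) a k T m :
  emaps f y y' -> (forall T m, K T m -> K' (f T) m) ->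
  jout y K a k T m -> jout y' K' a k (f T) m.
Proof.
  intros Hy HK (cs & T' & E & H1 & H2). exists cs, (f T'); repeat split; auto.
  apply emap_sum in H2. intros v e. specialize (H2 v e). unfold eadd, cl in *.
  now rewrite Hy in H2.
Qed.

(** The hypothesis is about [kbind] and not about [K] alone, since the binder may shadow the name
    that [f] acts on. *)
Lemma jin_emap y y' (K K' : quant) a k T m :
  (forall B T m, (forall U U', B U -> (forall e, U' e <= U e) -> B U') ->
     kbind y B K T m -> kbind y' B K' (f T) m) ->
  jin y K a k T m -> jin y' K' a k (f T) m.
Proof.
  intros HK (cs & E & H). exists cs; split; auto. apply HK; auto.
  intros U U' H1 H2 e. specialize (H1 e); specialize (H2 e); lia.
Qed.

Lemma jsel_emap l (K K' : quant) a k T m :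
  (forall T m, K T m -> K' (f T) m) ->
  jsel l K a k T m -> jsel l K' a k (f T) m.
Proof.
  intros HK (E & T' & H1 & H2). split; auto. exists (f T'); split; auto.
  now apply (emap_le f Hf).
Qed.

Lemma jcase_emap (A : Type) (h h' : A -> quant) (bs : list (label * A)) a k T m :
  (forall l b, In (l, b) bs -> forall T m, h b T m -> h' b (f T) m) ->
  jcase (map (fun b => (fst b, h (snd b))) bs) a k T m ->
  jcase (map (fun b => (fst b, h' (snd b))) bs) a k (f T) m.
Proof.
  intros HK (l & E & H). exists l; split; auto. intros K HKin.
  apply in_map_iff in HKin as ([l' b] & E' & Hin). simpl in E'. injection E' as <- <-.
  destruct (H (h b)) as (T' & H1 & H2).
  - apply in_map_iff. exists (l', b); auto.
  - exists (f T'); split; [eapply HK; eauto | now apply (emap_le f Hf)].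
Qed.

Lemma kcall_emap x x' y y' (K K' : quant) T n :
  emaps f x x' -> emaps f y y' -> (forall T m, K T m -> K' (f T) m) ->
  kcall x y K T n -> kcall x' y' K' (f T) n.
Proof.
  intros Hx Hy HK (a & T' & m & H1 & H2 & E). exists a, (f T'), m; repeat split; auto.
  apply emap_sum in H2. intros v e. specialize (H2 v e).
  change (f T' v e + f (eadd (one x (EM (PCall a))) (one y (EP [a]))) v e <= f T v e) in H2.
  rewrite (emap_add f Hf) in H2. unfold one in H2. rewrite Hx, Hy in H2. exact H2.
Qed.

Lemma kdom_emap (K K' : quant) T n :
  (forall T m, K T m -> K' (f T) m) -> kdom K T n -> kdom K' (f T) n.
Proof.
  intros HK (T' & m & H1 & H2 & E). exists (f T'), m; repeat split; auto.
  now apply (emap_le f Hf).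
Qed.

Lemma kpar_emap (K1 K2 K1' K2' : quant) T n :
  (forall T m, K1 T m -> K1' (f T) m) -> (forall T m, K2 T m -> K2' (f T) m) ->
  kpar K1 K2 T n -> kpar K1' K2' (f T) n.
Proof.
  intros HK1 HK2 (T1 & n1 & T2 & n2 & H1 & H2 & H3 & E).
  exists (f T1), n1, (f T2), n2; repeat split; auto. now apply emap_sum.
Qed.

Lemma copies_emap (R R' : pt -> quant) aa : forall T n,
  (forall a T m, R a T m -> R' a (f T) m) ->
  copies R aa T n -> copies R' aa (f T) n.
Proof.
  induction aa as [|a aa IH]; simpl; auto.
  intros T n HR (T1 & n1 & T2 & n2 & H1 & H2 & H3 & E).
  exists (f T1), n1, (f T2), n2; repeat split; auto. now apply emap_sum.
Qed.

Lemma krep_emap x x' y y' (K K' : quant) T n :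
  emaps f x x' ->
  (forall B T m, (forall U U', B U -> (forall e, U' e <= U e) -> B U') ->
     kbind y B K T m -> kbind y' B K' (f T) m) ->
  krep x y K T n -> krep x' y' K' (f T) n.
Proof.
  intros Hx HK (aa & T0 & H1 & H2). exists aa, (f T0); split.
  - eapply copies_emap; [|exact H1]. intros a T1 m H. apply HK; auto.
    intros U U' H3 H4 e. specialize (H3 e); specialize (H4 e); lia.
  - apply emap_sum in H2. intros v e. specialize (H2 v e). unfold eadd, one in *.
    now rewrite Hx in H2.
Qed.

Lemma kfwd_emap x x' y y' T n :
  emaps f x x' -> emaps f y y' -> kfwd x y T n -> kfwd x' y' (f T) n.
Proof.
  intros Hx Hy (s & a & Ha & H & E). exists s, a; repeat split; auto.
  apply emap_sum in H. intros v e. specialize (H v e). unfold eadd, one in *.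
  now rewrite Hx, Hy in H.
Qed.
End Emap.

Definition downward (B : (ent -> nat) -> Prop) : Prop :=
  forall U U', B U -> (forall e, U' e <= U e) -> B U'.

Lemma kbind_clr x y B (K : quant) T n :
  (x <> y -> forall T m, K T m -> K (clr x T) m) -> downward B ->
  kbind y B K T n -> kbind y B K (clr x T) n.
Proof.
  intros HK HB (T' & H1 & H2 & H3). destruct (Nat.eq_dec x y) as [->|Hxy].
  - exists T'; repeat split; auto. intros v e Hv. spec v e. unfold clr; env_simp. auto.
  - exists (clr x T'); repeat split; auto.
    + eapply HB; [exact H2|]. intros e; unfold clr; env_simp; auto.
    + intros v e Hv. spec v e. unfold clr; env_simp; auto.
Qed.

Ltac split_not :=
  repeat match goal with H : ~ (_ \/ _) |- _ => apply Decidable.not_or in H as [? H] end.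

Lemma not_in_remove x y l : ~ In x (remove Nat.eq_dec y l) -> x <> y -> ~ In x l.
Proof. intros H Hxy Hin. apply H. now apply in_in_remove. Qed.

(** A name that is not free is touched only under its own binders, which supply resources of their
    own. *)
Lemma qt_clr x P : ~ In x (fn P) -> forall T n, qt P T n -> qt P (clr x T) n.
Proof.
  induction P using proc_nested_ind; simpl; intros Hx T n H'; auto;
    rewrite ?in_app_iff in *; split_not.
  - revert H'; apply kpar_emap; auto using emap_clr.
  - revert H'; apply kbind_clr; [eauto using not_in_remove | exact valid_le].
  - destruct H' as [H'|H']; [left|right]; revert H'.
    + apply kact_emap; auto using emap_clr, emaps_clr. intros a k T0 m.
      apply jout_emap; auto using emap_clr, emaps_clr.
    + apply kcall_emap; auto using emap_clr, emaps_clr.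
  - revert H'; apply kact_emap; auto using emap_clr, emaps_clr. intros a k T0 m.
    apply jin_emap. intros B T1 m1 HB. apply kbind_clr; eauto using not_in_remove.
  - revert H'; apply krep_emap; auto using emap_clr, emaps_clr.
    intros B T1 m1 HB. apply kbind_clr; eauto using not_in_remove.
  - revert H'; apply kfwd_emap; auto using emap_clr, emaps_clr.
  - revert H'; apply kact_emap; auto using emap_clr, emaps_clr. intros a k T0 m.
    apply jcase_emap; auto using emap_clr. intros l b Hin. apply (H _ _ Hin).
    intros Hx'. apply Hx. apply in_flat_map. exists (l, b); auto.
  - revert H'; apply kact_emap; auto using emap_clr, emaps_clr. intros a k T0 m.
    apply jsel_emap; auto using emap_clr.
  - revert H'; apply kact_emap; auto using emap_clr, emaps_clr. intros a k T0 m.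
    apply jout_emap; auto using emap_clr, emaps_clr.
  - revert H'; apply kact_emap; auto using emap_clr, emaps_clr. intros a k T0 m.
    apply jin_emap. intros B T1 m1 HB. apply kbind_clr; eauto using not_in_remove.
  - revert H'; apply kdom_emap; auto using emap_clr.
  - revert H'; apply kdom_emap; auto using emap_clr.
Qed.

Lemma kbind_ren y z v B P T n :
  y <> v -> (forall T m, qt P T m -> qt (psub y z P) (ren y z T) m) -> downward B ->
  kbind v B (qt P) T n ->
  kbind v B (qt (if Nat.eq_dec v z then P else psub y z P)) (ren y z T) n.
Proof.
  intros Hv HK HB (T' & H1 & H2 & H3). destruct (Nat.eq_dec v z) as [->|Hvz].
  - exists T'; repeat split; auto. intros w e Hw. spec w e. unfold ren.
    repeat destruct Nat.eq_dec; subst; try congruence; lia.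
  - exists (ren y z T'); repeat split; auto.
    + eapply HB; [exact H2|]. intros e. unfold ren; repeat destruct Nat.eq_dec; subst; congruence || lia.
    + intros w e Hw. pose proof (H3 w e); pose proof (H3 y e); pose proof (H3 z e). unfold ren.
      repeat destruct Nat.eq_dec; subst; try congruence; try lia.
Qed.

Lemma qt_psub y z P : ~ In y (bn P) ->
  forall T n, qt P T n -> qt (psub y z P) (ren y z T) n.
Proof.
  induction P using proc_nested_ind; simpl; intros Hy T n H'; auto;
    rewrite ?in_app_iff in *; split_not.
  - revert H'; apply kpar_emap; auto using emap_ren.
  - assert (Hb : kbind y0 valid (qt (if Nat.eq_dec y0 z then P else psub y z P)) (ren y z T) n)
      by (revert H'; apply kbind_ren; [auto | auto | exact valid_le]).
    destruct (Nat.eq_dec y0 z); exact Hb.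
  - destruct H' as [H'|H']; [left|right]; revert H'.
    + apply kact_emap; auto using emap_ren, emaps_ren. intros a k T0 m.
      apply jout_emap; auto using emap_ren, emaps_ren.
    + apply kcall_emap; auto using emap_ren, emaps_ren.
  - revert H'; apply kact_emap; auto using emap_ren, emaps_ren. intros a k T0 m.
    apply jin_emap. intros B T1 m1 HB. apply kbind_ren; auto.
  - revert H'; apply krep_emap; auto using emap_ren, emaps_ren.
    intros B T1 m1 HB. apply kbind_ren; auto.
  - revert H'; apply kfwd_emap; auto using emap_ren, emaps_ren.
  - rewrite map_map. simpl.
    revert H'; apply kact_emap; auto using emap_ren, emaps_ren. intros a k T0 m.
    apply (jcase_emap _ (emap_ren y z) _ qt (fun b => qt (psub y z b))).
    intros l b Hin. apply (H _ _ Hin).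
    intros Hx'. apply Hy. apply in_flat_map. exists (l, b); auto.
  - revert H'; apply kact_emap; auto using emap_ren, emaps_ren. intros a k T0 m.
    apply jsel_emap; auto using emap_ren.
  - revert H'; apply kact_emap; auto using emap_ren, emaps_ren. intros a k T0 m.
    apply jout_emap; auto using emap_ren, emaps_ren.
  - revert H'; apply kact_emap; auto using emap_ren, emaps_ren. intros a k T0 m.
    apply jin_emap. intros B T1 m1 HB. apply kbind_ren; auto.
  - revert H'; apply kdom_emap; auto using emap_ren.
  - revert H'; apply kdom_emap; auto using emap_ren.
Qed.

Lemma kbind_pull y z v B P T n :
  y <> v -> ~ In y (fn P) ->
  (forall T m, qt (psub y z P) T m -> qt P (pull y z T) m) -> downward B ->
  kbind v B (qt (if Nat.eq_dec v z then P else psub y z P)) T n ->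
  kbind v B (qt P) (pull y z T) n.
Proof.
  intros Hv Hfn HK HB (T' & H1 & H2 & H3). destruct (Nat.eq_dec v z) as [->|Hvz].
  (* The binder shadows [z], so nothing was substituted in the body; only [y], which is not free
     there, has to be erased. *)
  - exists (clr y T'); repeat split; auto using qt_clr.
    + eapply HB; [exact H2|]. intros e. unfold clr; destruct Nat.eq_dec; lia.
    + intros w e Hw. spec w e. unfold pull, clr, rn.
      repeat destruct Nat.eq_dec; subst; try congruence; lia.
  - exists (pull y z T'); repeat split; auto.
    + eapply HB; [exact H2|]. intros e. unfold pull, rn; repeat destruct Nat.eq_dec; subst; congruence || lia.
    + intros w e Hw. pose proof (H3 w e); pose proof (H3 y e). unfold pull, rn.
      repeat destruct Nat.eq_dec; subst; try congruence; try lia; auto.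
Qed.

(* The converse of [qt_psub]; it cannot be obtained by substituting back, because [z] may be
   bound in [P]. *)
Lemma qt_psub_inv y z P : ~ In y (fn P) -> ~ In y (bn P) ->
  forall T n, qt (psub y z P) T n -> qt P (pull y z T) n.
Proof.
  induction P using proc_nested_ind; simpl; intros Hf Hy T n H'; auto;
    rewrite ?in_app_iff in *; split_not.
  - revert H'; apply kpar_emap; auto using emap_pull.
  - assert (Hb : kbind y0 valid (qt (if Nat.eq_dec y0 z then P else psub y z P)) T n)
      by (destruct (Nat.eq_dec y0 z); exact H').
    revert Hb; apply kbind_pull; [auto | eauto using not_in_remove | | exact valid_le].
    apply IHP; eauto using not_in_remove.
  - destruct H' as [H'|H']; [left|right]; revert H'.
    + apply kact_emap; auto using emap_pull, emaps_pull. intros a k T0 m.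
      apply jout_emap; auto using emap_pull, emaps_pull.
    + apply kcall_emap; auto using emap_pull, emaps_pull.
  - assert (~ In y (fn P)) by eauto using not_in_remove.
    revert H'; apply kact_emap; auto using emap_pull, emaps_pull. intros a k T0 m.
    apply jin_emap. intros B T1 m1 HB. apply kbind_pull; auto.
  - assert (~ In y (fn P)) by eauto using not_in_remove.
    revert H'; apply krep_emap; auto using emap_pull, emaps_pull.
    intros B T1 m1 HB. apply kbind_pull; auto.
  - revert H'; apply kfwd_emap; auto using emap_pull, emaps_pull.
  - rewrite map_map in H'. simpl in H'.
    revert H'; apply kact_emap; auto using emap_pull, emaps_pull. intros a k T0 m.
    apply (jcase_emap _ (emap_pull y z) _ (fun b => qt (psub y z b)) qt).
    intros l b Hin. apply (H _ _ Hin).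
    + intros Hx'. apply Hf. apply in_flat_map. exists (l, b); auto.
    + intros Hx'. apply Hy. apply in_flat_map. exists (l, b); auto.
  - revert H'; apply kact_emap; auto using emap_pull, emaps_pull. intros a k T0 m.
    apply jsel_emap; auto using emap_pull.
  - revert H'; apply kact_emap; auto using emap_pull, emaps_pull. intros a k T0 m.
    apply jout_emap; auto using emap_pull, emaps_pull.
  - assert (~ In y (fn P)) by eauto using not_in_remove.
    revert H'; apply kact_emap; auto using emap_pull, emaps_pull. intros a k T0 m.
    apply jin_emap. intros B T1 m1 HB. apply kbind_pull; auto.
  - revert H'; apply kdom_emap; auto using emap_pull.
  - revert H'; apply kdom_emap; auto using emap_pull.
Qed.

Lemma kbind_alpha y y' B P T n : ~ In y' (fn P) -> ~ In y' (bn P) -> downward B ->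
  kbind y B (qt P) T n <-> kbind y' B (qt (psub y' y P)) T n.
Proof.
  intros Hf Hb HB; split; intros (T' & H1 & H2 & H3).
  (* Resources already present at [y'] belong to a different channel and must not be added to those
     of the renamed binder. *)
  - exists (ren y' y (clr y' T')); repeat split.
    + apply qt_psub; auto. destruct (Nat.eq_dec y y') as [->|]; apply qt_clr; auto.
    + eapply HB; [exact H2|]. intros e. unfold ren, clr.
      repeat destruct Nat.eq_dec; subst; congruence || lia.
    + intros w e Hw. spec w e. unfold ren, clr.
      repeat destruct Nat.eq_dec; subst; try congruence; try lia; auto.
  - exists (pull y' y T'); repeat split.
    + now apply qt_psub_inv.
    + eapply HB; [exact H2|]. intros e. unfold pull, rn.
      repeat destruct Nat.eq_dec; subst; congruence || lia.
    + intros w e Hw. spec w e. unfold pull, rn.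
      repeat destruct Nat.eq_dec; subst; try congruence; try lia; auto.
Qed.

Lemma qt_dsub w a P : qt (dsub w a P) = qt P.
Proof.
  induction P using proc_nested_ind; simpl; try rewrite IHP; try rewrite IHP1, IHP2; auto.
  - rewrite map_map. do 2 f_equal. apply map_ext_in. intros [l P] Hin. simpl.
    now rewrite (H _ _ Hin).
  - destruct (Nat.eq_dec a0 a); simpl; now rewrite ?IHP.
Qed.

(** * Structural congruence *)

Lemma pred_ext (K K' : quant) : (forall T n, K T n <-> K' T n) -> K = K'.
Proof.
  intros H. extensionality T; extensionality n. now apply propositional_extensionality.
Qed.

Lemma qt_alpha y y' P B : ~ In y' (fn P) -> ~ In y' (bn P) -> downward B ->
  kbind y B (qt P) = kbind y' B (qt (psub y' y P)).
Proof. intros; apply pred_ext; intros; now apply kbind_alpha. Qed.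

Lemma downward_atmost V : downward (atmost V).
Proof. intros U U' H1 H2 e. specialize (H1 e); specialize (H2 e); lia. Qed.

Lemma qt_jin_alpha y y' P : ~ In y' (fn P) -> ~ In y' (bn P) ->
  jin y (qt P) = jin y' (qt (psub y' y P)).
Proof.
  intros H1 H2. extensionality a; extensionality k. apply pred_ext. intros T n.
  unfold jin. split; intros (cs & E & H); exists cs; split; auto; revert H;
    apply kbind_alpha; auto using downward_atmost.
Qed.

Lemma kfwd_sym x y T n : kfwd x y T n -> kfwd y x T n.
Proof.
  intros (s & a & Ha & H & E). exists (negb s), a; repeat split; auto.
  rewrite Bool.negb_involutive. ele_tac.
Qed.

Lemma valid_zero : valid (fun _ => 0).
Proof. exists []; repeat split; [left; simpl; lia | intros; lia | intros; lia]. Qed.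

Lemma qt_nu_swap x y P T n : qt (PNu x (PNu y P)) T n -> qt (PNu y (PNu x P)) T n.
Proof.
  simpl. intros (T1 & (T2 & H1 & H2 & H3) & H4 & H5).
  destruct (Nat.eq_dec x y) as [->|Hxy].
  - exists T1; repeat split; auto. exists T2; auto.
  - exists (fun v e => if Nat.eq_dec v y then T2 v e else T v e); repeat split.
    + exists T2; repeat split; auto.
      * eapply valid_le; [exact H4|]. intros e. apply H3; auto.
      * intros v e Hv. destruct Nat.eq_dec; auto.
        pose proof (H3 v e); pose proof (H5 v e). lia.
    + eapply valid_le; [exact H2|]. intros e. destruct Nat.eq_dec; congruence || lia.
    + intros v e Hv. destruct Nat.eq_dec; congruence || lia.
Qed.

Lemma qt_scope P Q x T n : ~ In x (fn P) ->
  qt (PPar P (PNu x Q)) T n <-> qt (PNu x (PPar P Q)) T n.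
Proof.
  simpl. intros Hx; split.
  - intros (T1 & n1 & T2 & n2 & H1 & (T3 & H3 & H4 & H5) & H6 & E).
    (* [T1] may hold resources at the outer [x]; they are of no use to [P] and could break coherence
       of the restricted [x]. *)
    exists (eadd (clr x T1) T3); repeat split.
    + exists (clr x T1), n1, T3, n2; repeat split; auto using qt_clr, ele_refl.
    + eapply valid_le; [exact H4|]. intros e. unfold eadd, clr. destruct Nat.eq_dec; congruence || lia.
    + intros v e Hv. spec v e. unfold eadd, clr. destruct Nat.eq_dec; try congruence.
      specialize (H5 Hv); lia.
  - intros (T1 & (T2 & n2 & T3 & n3 & H1 & H2 & H3 & E) & H4 & H5).
    exists (clr x T2), n2, (clr x T3), n3; repeat split; auto using qt_clr.
    + exists T3; repeat split; auto.
      * eapply valid_le; [exact H4|]. intros e. spec x e. lia.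
      * intros v e Hv. unfold clr. destruct Nat.eq_dec; congruence || lia.
    + intros v e. spec v e. unfold eadd, clr. destruct Nat.eq_dec; subst; try lia.
Qed.

(** Because this is an equality, closure under contexts is plain rewriting, even inside the branch
    list of [PCase]. *)
Theorem qt_scong P Q : scong P Q -> qt P = qt Q.
Proof.
  induction 1; simpl; try rewrite IHscong; try congruence; auto.
  - apply pred_ext; intros T n; split.
    + intros (T1 & n1 & T2 & n2 & H1 & H2 & H3 & E). subst. rewrite Nat.add_0_r.
      eapply qt_mono; [exact H1|]. ele_tac.
    + intros H. exists T, n, (fun _ _ => 0), 0; repeat split; auto. ele_tac.
  - apply pred_ext; intros T n; split.
    + intros (T1 & H1 & H2 & H3); auto.
    + intros H. exists (fun _ _ => 0); repeat split; auto using valid_zero. intros v e; lia.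
  - apply pred_ext; intros T n; split; apply kfwd_sym.
  - apply pred_ext; intros T n; split; intros (T1 & n1 & T2 & n2 & H1 & H2 & H3 & E);
      exists T2, n2, T1, n1; repeat split; auto; try lia; ele_tac.
  - apply pred_ext; intros T n; split.
    + intros (T1 & n1 & T2 & n2 & (T3 & n3 & T4 & n4 & H1 & H4 & H5 & E1) & H2 & H3 & E).
      exists T3, n3, (eadd T4 T2), (n4 + n2); repeat split; auto; try lia; [|ele_tac].
      exists T4, n4, T2, n2; repeat split; auto using ele_refl.
    + intros (T1 & n1 & T2 & n2 & H1 & (T3 & n3 & T4 & n4 & H2 & H4 & H5 & E1) & H3 & E).
      exists (eadd T1 T3), (n1 + n3), T4, n4; repeat split; auto; try lia; [|ele_tac].
      exists T1, n1, T3, n3; repeat split; auto using ele_refl.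
  - apply pred_ext; intros; now apply (qt_scope P Q).
  - apply pred_ext; intros T n; split; apply (qt_nu_swap _ _ P).
  - apply qt_alpha; auto. exact valid_le.
  - now rewrite (qt_jin_alpha y y').
  - unfold krep. extensionality T; extensionality n. do 2 f_equal.
    extensionality aa. f_equal. extensionality T0. do 2 f_equal. extensionality a.
    apply qt_alpha; auto using downward_atmost.
  - now rewrite (qt_jin_alpha y y').
  - now rewrite qt_dsub.
  - rewrite !map_app; simpl. now rewrite IHscong.
Qed.

(** * Subject reduction *)

(* [F] stands for the rest of the system: a call shrinks the offer of its server, which must remain
   coherent with the other clients. *)
Definition upd (T T' : env) : Prop :=
  forall v F, valid (fun e => T v e + F e) -> valid (fun e => T' v e + F e).

Lemma ele_upd T T' : ele T' T -> upd T T'.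
Proof. intros H v F HV. eapply valid_le; [exact HV|]. intros e. specialize (H v e). simpl; lia. Qed.

Lemma upd_trans T1 T2 T3 : upd T1 T2 -> upd T2 T3 -> upd T1 T3.
Proof. intros H1 H2 v F HV. auto. Qed.

Ltac units :=
  unfold unit_ent, side in *; simpl in *;
  repeat match goal with
  | H : context [if ent_dec ?a ?b then _ else _] |- _ => destruct (ent_dec a b)
  | |- context [if ent_dec ?a ?b then _ else _] => destruct (ent_dec a b)
  | H : context [if pt_dec ?a ?b then _ else _] |- _ => destruct (pt_dec a b)
  | |- context [if pt_dec ?a ?b then _ else _] => destruct (pt_dec a b)
  end; subst; try congruence; try lia.

(** * Coherence on a single channel *)

Lemma count_in a M n : S n <= count_occ pt_dec M a -> In a M.
Proof. intros H. apply (count_occ_In pt_dec). lia. Qed.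

Lemma valid_clients U a b : valid U -> ~ is_call a ->
  (forall e, unit_ent (EM a) e + unit_ent (EM b) e <= U e) -> False.
Proof.
  intros (M & HM & H1 & _) Ha H.
  pose proof (H (EM a)) as Ea; pose proof (H (EM b)) as Eb.
  specialize (H1 a) as Ma; specialize (H1 b) as Mb.
  assert (In a M) by (apply (count_in a M 0); units).
  destruct HM as [HM|HM]; [|apply Ha, HM; auto].
  destruct M as [|c [|? ?]]; simpl in HM; try lia; simpl in *; try tauto. units.
Qed.

Lemma valid_providers U M1 M2 : valid U ->
  (forall e, unit_ent (EP M1) e + unit_ent (EP M2) e <= U e) -> False.
Proof.
  intros (M & _ & _ & H2) H.
  pose proof (H (EP M1)); pose proof (H (EP M2)).
  specialize (H2 M1) as Ma; specialize (H2 M2) as Mb. units.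
Qed.

Lemma valid_provided U M b : valid U ->
  (forall e, unit_ent (EP M) e + unit_ent (EM b) e <= U e) -> In b M.
Proof.
  intros (M0 & _ & H1 & H2) H.
  pose proof (H (EP M)); pose proof (H (EM b)).
  specialize (H2 M). specialize (H1 b).
  assert (M0 = M) as -> by units. apply (count_in _ _ 0). units.
Qed.

(** A non-call point in the offer rules out the shared alternative of [shareable], so the offer is
    exactly [[a]]. *)
Lemma valid_linear_client U a : valid U -> ~ is_call a ->
  (forall e, unit_ent (EM a) e <= U e) ->
  forall e, U e <= unit_ent (EM a) e + unit_ent (EP [a]) e.
Proof.
  intros (M & HM & H1 & H2) Ha H.
  pose proof (H (EM a)) as Ea. specialize (H1 a) as Ma.
  assert (In a M) as Hin by (apply (count_in a M 0); units).
  destruct HM as [HM|HM]; [|exfalso; apply Ha, HM; auto].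
  destruct M as [|c [|? ?]]; simpl in HM; try lia; simpl in Hin; try tauto.
  destruct Hin as [->|[]]. intros [M'|b]; [specialize (H2 M')|specialize (H1 b)]; units.
Qed.

Lemma valid_linear_provider U a : valid U ->
  (forall e, unit_ent (EP [a]) e <= U e) ->
  forall e, U e <= unit_ent (EM a) e + unit_ent (EP [a]) e.
Proof.
  intros (M & HM & H1 & H2) H.
  pose proof (H (EP [a])) as Ea. specialize (H2 [a]) as Ma.
  assert (M = [a]) as -> by units.
  intros [M'|b]; [specialize (H2 M')|specialize (H1 b)]; units.
Qed.

Lemma valid_link a : valid (fun e => unit_ent (EM a) e + unit_ent (EP [a]) e).
Proof.
  exists [a]; repeat split; [left; simpl; lia | intros b; units | intros M'; units].
Qed.

(** The two ends exhaust a linear channel: neither [R] nor the rest of the system holds anything at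
    [x], so both ends may move on to any common [k]. *)
Lemma upd_link x a k R T :
  ele (eadd R (eadd (one x (EP [a])) (one x (EM a)))) T ->
  upd T (eadd R (eadd (one x (EP [k])) (one x (EM k)))).
Proof.
  intros H v F HV. destruct (Nat.eq_dec v x) as [->|Hv].
  - apply (valid_le _ _ (valid_link k)). intros e.
    assert (HU : forall e, R x e + F e = 0).
    { intros e'. pose proof (H x e') as He.
      pose proof (valid_linear_provider _ a HV) as Hl. env_simp.
      assert (Hl' := Hl ltac:(intros e''; pose proof (H x e''); env_simp; lia) e').
      simpl in Hl'. lia. }
    specialize (HU e). env_simp; lia.
  - eapply valid_le; [exact HV|]. intros e. specialize (H v e). env_simp; lia.
Qed.

(** Offer and demand lose the same point at once, so the remaining clients, including those in the
    frame, stay covered. *)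
Lemma upd_call x a l1 l2 R T :
  ele (eadd R (eadd (one x (EP (map PCall (l1 ++ a :: l2)))) (one x (EM (PCall a))))) T ->
  upd T (eadd R (one x (EP (map PCall (l1 ++ l2))))).
Proof.
  intros H v F HV. destruct (Nat.eq_dec v x) as [->|Hv].
  - destruct HV as (M & HM & H1 & H2).
    pose proof (H x (EP (map PCall (l1 ++ a :: l2)))) as He.
    specialize (H2 (map PCall (l1 ++ a :: l2))) as HM'.
    assert (M = map PCall (l1 ++ a :: l2)) as -> by (env_simp; units).
    exists (map PCall (l1 ++ l2)); repeat split.
    + right. intros b Hb. apply in_map_iff in Hb as (b' & <- & _). eauto.
    + intros b. specialize (H1 b). pose proof (H x (EM b)) as Hb.
      rewrite map_app in *. simpl in *. rewrite count_occ_app in *. simpl in H1. env_simp; units.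
    + intros M'. specialize (H2 M'). pose proof (H x (EP M')) as Hb. env_simp; units.
  - eapply valid_le; [exact HV|]. intros e. specialize (H v e). env_simp; lia.
Qed.

(** * Interaction of two threads on a channel *)

Definition linear_point (J : pt -> pt -> quant) : Prop :=
  forall a k T m, J a k T m -> ~ is_call a /\ a <> PDag.

Lemma linear_jout y K : linear_point (jout y K).
Proof. intros a k T m (cs & T' & -> & _). split; [intros [b E]|]; discriminate. Qed.
Lemma linear_jin y K : linear_point (jin y K).
Proof. intros a k T m (cs & -> & _). split; [intros [b E]|]; discriminate. Qed.
Lemma linear_jsel l K : linear_point (jsel l K).
Proof. intros a k T m (-> & _). split; [intros [b E]|]; discriminate. Qed.
Lemma linear_jcase bs : linear_point (jcase bs).
Proof. intros a k T m (l & -> & _). split; [intros [b E]|]; discriminate. Qed.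

Lemma not_call_dag : ~ is_call PDag.
Proof. intros [b E]; discriminate. Qed.

(** Coherence puts the two threads at opposite ends of one point. Neither can be blocked: [PDag] is
    no point of a prefix and tolerates no second client. The equality [k1 = k2] is left to the
    caller, who reads it off the shape of [a]. *)
Lemma react x J1 J2 T1 T2 n1 n2 :
  linear_point J1 -> linear_point J2 ->
  kact x J1 T1 n1 -> kact x J2 T2 n2 -> valid (eadd T1 T2 x) ->
  exists a k1 k2 U1 m1 U2 m2, J1 a k1 U1 m1 /\ J2 a k2 U2 m2 /\ n1 = S m1 /\ n2 = S m2 /\
    (k1 = k2 -> upd (eadd T1 T2) (eadd U1 U2)).
Proof.
  intros L1 L2 [[E1 B1]|(s1 & a1 & k1 & R1 & U1 & m1 & HJ1 & A1 & C1 & E1)]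
    [[E2 B2]|(s2 & a2 & k2 & R2 & U2 & m2 & HJ2 & A2 & C2 & E2)] HV.
  - apply one_le in B1, B2. exfalso. apply (valid_clients _ PDag PDag HV not_call_dag).
    intros e. pose proof (B1 x e); pose proof (B2 x e). env_simp; lia.
  - apply one_le in B1. destruct (L2 _ _ _ _ HJ2) as [Hc Hd]. exfalso. destruct s2.
    + destruct (valid_provided _ [a2] PDag HV) as [|[]]; auto.
      intros e. pose proof (B1 x e); pose proof (C2 x e). env_simp; units.
    + apply (valid_clients _ PDag a2 HV not_call_dag).
      intros e. pose proof (B1 x e); pose proof (C2 x e). env_simp; units.
  - apply one_le in B2. destruct (L1 _ _ _ _ HJ1) as [Hc Hd]. exfalso. destruct s1.
    + destruct (valid_provided _ [a1] PDag HV) as [|[]]; auto.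
      intros e. pose proof (B2 x e); pose proof (C1 x e). env_simp; units.
    + apply (valid_clients _ PDag a1 HV not_call_dag).
      intros e. pose proof (B2 x e); pose proof (C1 x e). env_simp; units.
  - destruct (L1 _ _ _ _ HJ1) as [Hc1 Hd1], (L2 _ _ _ _ HJ2) as [Hc2 Hd2].
    assert (Hs : s2 = negb s1 /\ a2 = a1).
    { assert (HC : forall e, unit_ent (side s1 a1) e + unit_ent (side s2 a2) e <= eadd T1 T2 x e)
        by (intros e; pose proof (C1 x e); pose proof (C2 x e); env_simp; lia).
      destruct s1, s2; simpl in *.
      - exfalso. eapply valid_providers; eauto.
      - destruct (valid_provided _ [a1] a2 HV HC) as [->|[]]; auto.
      - destruct (valid_provided _ [a2] a1 HV) as [->|[]]; auto.
        intros e; specialize (HC e); lia.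
      - exfalso. eapply valid_clients; [exact HV | exact Hc1 | exact HC]. }
    destruct Hs as [-> ->].
    exists a1, k1, k2, U1, m1, U2, m2; repeat split; auto. intros <-.
    assert (HU : upd (eadd T1 T2)
              (eadd (eadd R1 R2) (eadd (one x (EP [k1])) (one x (EM k1))))).
    { apply (upd_link x a1). destruct s1; simpl in *; ele_tac. }
    eapply upd_trans; [exact HU|]. apply ele_upd. destruct s1; simpl in *; ele_tac.
Qed.

Lemma copies_split R aa : forall T n a, In a aa -> copies R aa T n ->
  exists l1 l2 T1 n1 T2 n2, aa = l1 ++ a :: l2 /\ R a T1 n1 /\ copies R (l1 ++ l2) T2 n2 /\
    ele (eadd T1 T2) T /\ n = n1 + n2.
Proof.
  induction aa as [|b aa IH]; simpl; [tauto|].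
  intros T n a Hin (T1 & n1 & T2 & n2 & H1 & H2 & H3 & E).
  destruct Hin as [->|Hin].
  - exists [], aa, T1, n1, T2, n2; repeat split; auto.
  - destruct (IH _ _ _ Hin H2) as (l1 & l2 & T3 & n3 & T4 & n4 & -> & H4 & H5 & H6 & E').
    exists (b :: l1), l2, T3, n3, (eadd T1 T4), (n1 + n4); repeat split; auto; try lia; [|ele_tac].
    exists T1, n1, T4, n4; repeat split; auto using ele_refl.
Qed.

(** The charge [V] at [y] covers what the body does at [z]; since [y] may already occur in the body,
    [ren] adds the two. *)
Lemma receive y z T' T V U :
  ele (eadd T (at_chan y V)) U -> atmost V (T' z) -> under z T' T -> ele (ren y z T') U.
Proof.
  intros HU HV Hu v e. pose proof (HU v e). pose proof (HU y e). pose proof (HU z e).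
  specialize (HV e). pose proof (Hu v e). pose proof (Hu y e). unfold ren.
  repeat destruct Nat.eq_dec; subst; env_simp; try lia.
  all: try (destruct (Nat.eq_dec v z); subst; lia).
Qed.

Lemma react_comm x y z P Q T1 T2 n1 n2 : ~ In y (bn P) ->
  kact x (jout y (qt Q)) T1 n1 -> kact x (jin z (qt P)) T2 n2 -> valid (eadd T1 T2 x) ->
  exists T' n', qt (PPar Q (psub y z P)) T' n' /\ n' < n1 + n2 /\ upd (eadd T1 T2) T'.
Proof.
  intros Hy H1 H2 HV.
  destruct (react _ _ _ _ _ _ _ (linear_jout y (qt Q)) (linear_jin z (qt P)) H1 H2 HV)
    as (a & k1 & k2 & U1 & m1 & U2 & m2 & (cs & T3 & -> & H3 & H4) & (cs' & E & T4 & H5 & H6 & H7)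
        & -> & -> & HU).
  injection E as <- <-. specialize (HU eq_refl).
  exists (eadd U1 U2), (m1 + m2); repeat split; auto; [|lia].
  exists T3, m1, (ren y z T4), m2; repeat split; auto using qt_psub.
  assert (ele (ren y z T4) (eadd U2 (cl y cs))) by (eapply receive; [apply ele_refl|exact H6|exact H7]).
  ele_tac.
Qed.

Lemma react_call x y z P Q T1 T2 n1 n2 : ~ In y (bn P) ->
  qt (POut x y Q) T1 n1 -> qt (PRep x z P) T2 n2 -> valid (eadd T1 T2 x) ->
  exists T' n', qt (PPar (PPar Q (psub y z P)) (PRep x z P)) T' n' /\ n' < n1 + n2 /\
    upd (eadd T1 T2) T'.
Proof.
  intros Hy H1 (aa & T0 & H2 & H3) HV.
  (* Every client at [x] draws on the server's offer and is therefore a call, which refutes the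
     readings of the output as a session prefix. *)
  assert (Hin : forall b, (forall e, unit_ent (EM b) e <= T1 x e) ->
            exists a, b = PCall a /\ In a aa).
  { intros b Hb. apply (valid_provided _ (map PCall aa) b) in HV.
    - apply in_map_iff in HV as (a & <- & ?). eauto.
    - intros e. specialize (Hb e). pose proof (H3 x e). env_simp; lia. }
  destruct H1 as [[[E B]|(s & a & k & R1 & U1 & m1 & (cs & T3 & -> & _) & A & C & E)]|
                  (a & T3 & m1 & H4 & H5 & E)].
  - apply one_le in B. destruct (Hin PDag) as (a & Ea & _); [|discriminate].
    intros e. specialize (B x e). env_simp; lia.
  - destruct s; simpl in C.
    + exfalso. apply (valid_providers _ [PCom cs k] (map PCall aa) HV).
      intros e. pose proof (H3 x e); pose proof (C x e). env_simp; lia.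
    + destruct (Hin (PCom cs k)) as (a & Ea & _); [|discriminate].
      intros e. pose proof (C x e). env_simp; lia.
  - assert (Ha : In a aa).
    { destruct (Hin (PCall a)) as (a' & Ea & Ha'); [|injection Ea as <-; auto].
      intros e. pose proof (H5 x e). env_simp; lia. }
    destruct (copies_split _ _ _ _ _ Ha H2)
      as (l1 & l2 & T4 & n3 & T5 & n4 & -> & (T6 & H6 & H7 & H8) & H9 & H10 & ->).
    assert (HR : ele (ren y z T6) (eadd T4 (one y (EP [a]))))
      by (eapply receive; [apply ele_refl|exact H7|exact H8]).
    exists (eadd (eadd T3 (eadd T5 (ren y z T6))) (one x (EP (map PCall (l1 ++ l2))))),
      (m1 + n3 + n4); repeat split; [| lia |].
    + exists (eadd T3 (ren y z T6)), (m1 + n3), (eadd T5 (one x (EP (map PCall (l1 ++ l2))))), n4.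
      repeat split; [| |ele_tac].
      * exists T3, m1, (ren y z T6), n3; repeat split; auto using qt_psub, ele_refl.
      * exists (l1 ++ l2), T5; split; auto using ele_refl.
    + apply (upd_call x a). ele_tac.
Qed.

(** The forwarder's point leaves [P] at most the opposite end at [x]. Renamed to [y], this is just
    what the forwarder held there, so the outer environment need not change. *)
Lemma react_fwd x y P T n : ~ In y (bn P) ->
  qt (PNu x (PPar (PFwd x y) P)) T n -> exists n', qt (psub y x P) T n' /\ n' < n.
Proof.
  intros Hy (T0 & (T1 & n1 & T2 & n2 & (s & a & Ha & H1 & ->) & H2 & H3 & ->) & HV & Hu).
  exists n2; split; [|lia].
  assert (HE : forall e, T0 x e <= unit_ent (side s a) e + unit_ent (side (negb s) a) e).
  { intros e. destruct s; simpl.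
    - rewrite Nat.add_comm. apply valid_linear_provider; auto.
      intros e'. pose proof (H1 x e') as H1'; pose proof (H3 x e'). simpl in H1'. env_simp; lia.
    - apply valid_linear_client; auto.
      intros e'. pose proof (H1 x e') as H1'; pose proof (H3 x e'). simpl in H1'. env_simp; lia. }
  eapply qt_mono; [apply qt_psub; eauto|]. intros v e. unfold ren.
  pose proof (HE e). pose proof (H1 x e); pose proof (H3 x e).
  pose proof (H1 v e); pose proof (H3 v e); pose proof (Hu v e).
  env_simp; try lia.
Qed.

Theorem subject_reduction : forall P P', red P P' -> forall T n, qt P T n -> (forall v, valid (T v)) ->
  exists T' n', qt P' T' n' /\ n' < n /\ upd T T'.
Proof.
  assert (Hsum : forall T T1 T2, ele (eadd T1 T2) T -> (forall v, valid (T v)) ->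
            upd T (eadd T1 T2) /\ (forall v, valid (eadd T1 T2 v))).
  { intros T T1 T2 H HV; split; [now apply ele_upd|]. intros v. eapply valid_le; [apply (HV v)|].
    intros e. apply (H v e). }
  assert (Hpar : forall P Q R, (forall T1 n1 T2 n2, qt P T1 n1 -> qt Q T2 n2 ->
              (forall v, valid (eadd T1 T2 v)) ->
              exists T' n', qt R T' n' /\ n' < n1 + n2 /\ upd (eadd T1 T2) T') ->
            forall T n, qt (PPar P Q) T n -> (forall v, valid (T v)) ->
              exists T' n', qt R T' n' /\ n' < n /\ upd T T').
  { intros P Q R HR T n (T1 & n1 & T2 & n2 & H1 & H2 & H3 & ->) HV.
    destruct (Hsum _ _ _ H3 HV) as [Hup HV'].
    destruct (HR _ _ _ _ H1 H2 HV') as (T' & n' & ? & ? & ?).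
    exists T', n'; eauto using upd_trans. }
  intros P P'; induction 1.
  - apply Hpar. intros T1 n1 T2 n2 [H1|H1] H2 HV; [eapply react_comm; eauto|].
    (* A call cannot meet an ordinary input: a call client and a linear point are incoherent on one
       channel. *)
    destruct H1 as (a & T3 & m1 & H4 & H5 & E). exfalso.
    destruct H2 as [[E2 B2]|(s2 & a2 & k2 & R2 & U2 & m2 & HJ2 & A2 & C2 & E2)].
    + apply one_le in B2. apply (valid_clients _ PDag (PCall a) (HV x) not_call_dag).
      intros e. pose proof (B2 x e); pose proof (H5 x e). env_simp; lia.
    + destruct (linear_jin _ _ _ _ _ _ HJ2) as [Hc _]. destruct s2; simpl in *.
      * destruct (valid_provided _ [a2] (PCall a) (HV x)) as [->|[]]; [|apply Hc; eexists; eauto].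
        intros e. pose proof (C2 x e); pose proof (H5 x e). env_simp; lia.
      * apply (valid_clients _ a2 (PCall a) (HV x) Hc).
        intros e. pose proof (C2 x e); pose proof (H5 x e). env_simp; lia.
  - apply Hpar. intros; eapply react_call; eauto.
  - apply Hpar. intros; eapply react_comm; eauto.
  - apply Hpar. intros T1 n1 T2 n2 (T3 & m1 & H1 & H2 & ->) (T4 & m2 & H3 & H4 & ->) HV.
    exists (eadd T1 T2), (m1 + m2); repeat split; try lia; [|apply ele_upd, ele_refl].
    exists T3, m1, T4, m2. rewrite qt_dsub. repeat split; auto. ele_tac.
  - intros T n HT HV. destruct (react_fwd _ _ _ _ _ H HT) as (n' & ? & ?).
    exists T, n'; repeat split; auto. apply ele_upd, ele_refl.
  - apply Hpar. intros T1 n1 T2 n2 H1 H2 HV.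
    destruct (react _ _ _ _ _ _ _ (linear_jsel _ _) (linear_jcase _) H1 H2 (HV x))
      as (a & k1 & k2 & U1 & m1 & U2 & m2 & (-> & T3 & H3 & H4) & (l' & E & H5) & -> & -> & HU).
    injection E as <- <-.
    destruct (H5 (qt Q)) as (T4 & H6 & H7).
    { apply in_map_iff. exists (l, Q); auto. }
    exists (eadd U1 U2), (m1 + m2); repeat split; try lia; auto.
    exists T3, m1, T4, m2; repeat split; auto. ele_tac.
  - apply Hpar. intros T1 n1 T2 n2 H1 H2 HV.
    destruct (IHred _ _ H1) as (T' & n' & H3 & H4 & H5).
    { intros v. eapply valid_le; [apply (HV v)|]. intros e; unfold eadd; lia. }
    exists (eadd T' T2), (n' + n2); repeat split; try lia.
    + exists T', n', T2, n2; repeat split; auto using ele_refl.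
    (* The idle component joins the frame. *)
    + intros v F HF. eapply valid_le; [apply (H5 v (fun e => T2 v e + F e))|].
      * eapply valid_le; [exact HF|]. intros e; unfold eadd; lia.
      * intros e; unfold eadd; lia.
  - intros T n (T1 & H1 & H2 & H3) HV.
    destruct (IHred _ _ H1) as (T2 & n' & H4 & H5 & H6).
    { intros v. destruct (Nat.eq_dec v x) as [->|Hv]; auto.
      eapply valid_le; [apply (HV v)|]. intros e; auto. }
    (* The inner [x] is private, so its resources must not show up at the outer channel of the same
       name. *)
    exists (clr x T2), n'; repeat split; auto.
    + exists T2; repeat split; auto.
      * eapply valid_le; [apply (H6 x (fun _ => 0))|intros e; cbv beta; lia].
        eapply valid_le; [exact H2|intros e; cbv beta; lia].
      * intros v e Hv. unfold clr. destruct Nat.eq_dec; congruence || lia.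
    + intros v F HF. destruct (Nat.eq_dec v x) as [->|Hv].
      * eapply valid_le; [exact HF|]. intros e. unfold clr. destruct Nat.eq_dec; congruence || lia.
      * eapply valid_le; [apply (H6 v F)|].
        -- eapply valid_le; [exact HF|]. intros e. specialize (H3 v e Hv). cbv beta; lia.
        -- intros e. unfold clr. destruct Nat.eq_dec; congruence || lia.
  - intros T n HT HV. rewrite (qt_scong _ _ H) in HT.
    destruct (IHred _ _ HT HV) as (T' & n' & ? & ? & ?).
    exists T', n'. rewrite <- (qt_scong _ _ H1). auto.
Qed.

Theorem qt_terminates P T n : qt P T n -> (forall v, valid (T v)) -> terminates P.
Proof.
  intros HT HV (f & <- & Hf).
  enough (H : forall n i T, qt (f i) T n -> (forall v, valid (T v)) -> False) by eauto.
  clear T n HT HV. induction n as [n IH] using lt_wf_ind. intros i T HT HV.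
  destruct (subject_reduction _ _ (Hf i) _ _ HT HV) as (T' & n' & H1 & H2 & H3).
  apply (IH n' H2 (S i) T' H1). intros v.
  eapply valid_le; [apply (H3 v (fun _ => 0))|intros e; cbv beta; lia].
  eapply valid_le; [apply (HV v)|intros e; cbv beta; lia].
Qed.

(** * Totality *)

Definition points := pt -> Prop.

(* The first disjunct of [TWith] excludes the empty set for the empty branching type. *)
Fixpoint tot (A : ty) (S : points) {struct A} : Prop :=
  S PDag \/
  match A with
  | TOne => S PNil
  | TLolli A B =>
      forall S1, tot A S1 -> tot B (fun b => exists a, S1 a /\ S (PCom [a] b))
  | TTens A B =>
      exists S1 S2, tot A S1 /\ tot B S2 /\ forall a b, S1 a -> S2 b -> S (PCom [a] b)
  | TWith ts =>
      (exists l a, S (PLab l a)) /\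
      forall l X, In (l, X) (map (fun p => (fst p, tot (snd p))) ts) -> X (fun a => S (PLab l a))
  | TPlus ts =>
      exists l X S1, In (l, X) (map (fun p => (fst p, tot (snd p))) ts) /\ X S1 /\
        forall a, S1 a -> S (PLab l a)
  | TBang A =>
      exists S1, tot A S1 /\ forall aa, Forall S1 aa -> S (PCom (map PCall aa) PNil)
  | TAt _ A => exists S1, tot A S1 /\ forall a, S1 a -> S (PCom [a] PNil)
  | TAll A | TEx A | TDown A => tot A S
  end.

Lemma ty_nested_ind (R : ty -> Prop) :
  R TOne ->
  (forall A B, R A -> R B -> R (TLolli A B)) ->
  (forall A B, R A -> R B -> R (TTens A B)) ->
  (forall ts, (forall l A, In (l, A) ts -> R A) -> R (TWith ts)) ->
  (forall ts, (forall l A, In (l, A) ts -> R A) -> R (TPlus ts)) ->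
  (forall A, R A -> R (TBang A)) ->
  (forall d A, R A -> R (TAt d A)) ->
  (forall A, R A -> R (TAll A)) ->
  (forall A, R A -> R (TEx A)) ->
  (forall A, R A -> R (TDown A)) ->
  forall A, R A.
Proof.
  intros H0 H1 H2 H3 H4 H5 H6 H7 H8 H9.
  fix IH 1. intros A; destruct A;
    [apply H0 | apply H1 | apply H2 | apply H3 | apply H4 | apply H5 | apply H6 | apply H7
    | apply H8 | apply H9]; try apply IH.
  all: induction ts as [|[l A] ts IHts]; simpl; [tauto|].
  all: intros l' A' [E|E]; [injection E as <- <-; apply IH | exact (IHts _ _ E)].
Qed.

Lemma in_tot l X (ts : list (label * ty)) :
  In (l, X) (map (fun p => (fst p, tot (snd p))) ts) <-> exists A, In (l, A) ts /\ X = tot A.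
Proof.
  rewrite in_map_iff. split.
  - intros ([l' A] & E & H). injection E as <- <-. eauto.
  - intros (A & H & ->). exists (l, A); auto.
Qed.

(** No type tests for a call at the head of a point, so calls may be discarded. The identity rule
    relies on this, as a forwarder relays only non-call points. *)
Lemma tot_mono A : forall S S' : points,
  (forall a, ~ is_call a -> S a -> S' a) -> tot A S -> tot A S'.
Proof.
  assert (ND : forall (S S' : points), (forall a, ~ is_call a -> S a -> S' a) -> S PDag -> S' PDag)
    by (intros S S' H; apply H; exact not_call_dag).
  assert (NC : forall (S S' : points), (forall a, ~ is_call a -> S a -> S' a) ->
             forall cs k, S (PCom cs k) -> S' (PCom cs k))
    by (intros S S' H cs k; apply H; intros [b E]; discriminate).
  assert (NL : forall (S S' : points), (forall a, ~ is_call a -> S a -> S' a) ->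
             forall l k, S (PLab l k) -> S' (PLab l k))
    by (intros S S' H l k; apply H; intros [b E]; discriminate).
  induction A using ty_nested_ind; intros S S' HS [HT|HT];
    specialize (ND _ _ HS); specialize (NC _ _ HS); specialize (NL _ _ HS);
    try (left; now apply ND); right; simpl in *.
  - apply HS; auto. intros [b E]; discriminate.
  - intros S1 H1. eapply IHA2; [|apply (HT S1 H1)]. intros b _ (a & Ha & Hb).
    exists a; split; eauto.
  - destruct HT as (S1 & S2 & H1 & H2 & H3). exists S1, S2; repeat split; eauto.
  - destruct HT as ((l & a & Ha) & HT). split; [eauto|].
    intros l' X HX. specialize (HT l' X HX). apply in_tot in HX as (A & HA & ->).
    eapply H; [exact HA| |exact HT]. eauto.
  - destruct HT as (l & X & S1 & HX & H1 & H2). exists l, X, S1; repeat split; eauto.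
  - destruct HT as (S1 & H1 & H2). exists S1; split; eauto.
  - destruct HT as (S1 & H1 & H2). exists S1; split; eauto.
  - eauto.
  - eauto.
  - eauto.
Qed.

(** Hence the set containing only [PDag] is total at every type and can stand in for an absent
    provider. *)
Lemma tot_dag A (S : points) : S PDag -> tot A S.
Proof. destruct A; simpl; auto. Qed.

Lemma tot_inhabited A : forall S : points, tot A S -> exists a, S a.
Proof.
  induction A using ty_nested_ind; intros S [HT|HT]; eauto; simpl in *.
  (* A total argument exists at every type: the silent one. *)
  - destruct (IHA2 _ (HT (fun a => a = PDag) (tot_dag _ _ eq_refl))) as (b & a & _ & H). eauto.
  - destruct HT as (S1 & S2 & H1 & H2 & H3).
    destruct (IHA1 _ H1) as [a Ha], (IHA2 _ H2) as [b Hb]. eauto.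
  - destruct HT as ((l & a & Ha) & _). eauto.
  - destruct HT as (l & X & S1 & HX & H1 & H2). apply in_tot in HX as (A & HA & ->).
    destruct (H _ _ HA _ H1) as [a Ha]. eauto.
  - destruct HT as (S1 & _ & H2). eauto.
  - destruct HT as (S1 & H1 & H2). destruct (IHA _ H1) as [a Ha]. eauto.
Qed.

(** Quantification is first-order: instantiation changes only the domain in [TAt], which [tot] does
    not inspect. *)
Lemma tot_topen w A : forall k, tot (topen k w A) = tot A.
Proof.
  induction A using ty_nested_ind; intros k; extensionality S; simpl; auto;
    rewrite ?IHA, ?IHA1, ?IHA2; auto; f_equal.
  all: assert (E : map (fun p => (fst p, tot (snd p))) (map (fun p => (fst p, topen k w (snd p))) ts)
         = map (fun p => (fst p, tot (snd p))) ts) by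
    (rewrite map_map; apply map_ext_in; intros [l A] HA; simpl; f_equal; eauto);
    now rewrite E.
Qed.

Lemma tot_tinst A w : tot (tinst A w) = tot A.
Proof. apply tot_topen. Qed.

(** * Resources of a typing context *)

Fixpoint linok (d : chan -> points) (D : ctx) (T : env) : Prop :=
  match D with
  | [] => forall v e, T v e = 0
  | (x, _, _) :: D' => exists a T', d x a /\ linok d D' T' /\ ele T (eadd (one x (EM a)) T')
  end.

Fixpoint cenv (L : list (chan * pt)) : env :=
  match L with
  | [] => fun _ _ => 0
  | (u, a) :: L' => eadd (one u (EM (PCall a))) (cenv L')
  end.

(** The calls form an explicit finite list, from which the number of server copies is later read
    off. *)
Definition callsok (g : chan -> points) (G : ctx) (T : env) : Prop :=
  exists L, (forall u a, In (u, a) L -> In u (names G) /\ g u a) /\ ele T (cenv L).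

Definition uses (g d : chan -> points) (G D : ctx) (T : env) : Prop :=
  exists T1 T2, callsok g G T1 /\ linok d D T2 /\ ele T (eadd T1 T2).

Definition provides (P : proc) (g d : chan -> points) (G D : ctx) (z : chan) : points :=
  fun c => exists n T, uses g d G D T /\ qt P (eadd (one z (EP [c])) T) n.

Definition good (g : chan -> points) (G : ctx) : Prop :=
  forall x A w, In (x, A, w) G -> tot A (g x).

Definition sem (G D : ctx) (P : proc) (z : chan) (C : ty) : Prop :=
  forall g d, good g G -> good d D -> tot C (provides P g d G D z).

Definition fupd (d : chan -> points) (x : chan) (S : points) : chan -> points :=
  fun v => if Nat.eq_dec v x then S else d v.

Lemma fupd_eq d x S : fupd d x S x = S.
Proof. unfold fupd. destruct Nat.eq_dec; congruence. Qed.

Lemma fupd_neq d x S v : v <> x -> fupd d x S v = d v.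
Proof. unfold fupd. destruct Nat.eq_dec; congruence. Qed.

Lemma NoDup_app_disjoint (A : Type) (l l' : list A) a : NoDup (l ++ l') -> In a l -> ~ In a l'.
Proof.
  intros H Hl Hl'. apply in_split in Hl' as (l1 & l2 & ->). rewrite app_assoc in H.
  apply NoDup_remove_2 in H. apply H. rewrite !in_app_iff. auto.
Qed.

Lemma names_app G D : names (G ++ D) = names G ++ names D.
Proof. apply map_app. Qed.

Lemma in_names x A w D : In (x, A, w) D -> In x (names D).
Proof. intros H. apply (in_map (fun e : chan * ty * dom => fst (fst e)) _ _ H). Qed.

Lemma good_fupd d D x A w S : ~ In x (names D) -> good d D -> tot A S ->
  good (fupd d x S) (D ++ [(x, A, w)]).
Proof.
  intros Hx HD HA y B w' Hin. apply in_app_iff in Hin as [Hin|[E|[]]].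
  - rewrite fupd_neq; eauto. intros ->. apply Hx. eauto using in_names.
  - injection E as <- <- <-. now rewrite fupd_eq.
Qed.

Lemma good_app d D1 D2 : good d (D1 ++ D2) -> good d D1 /\ good d D2.
Proof. intros H; split; intros x A w Hin; eapply H; apply in_app_iff; eauto. Qed.

Lemma good_last d D x A w : good d (D ++ [(x, A, w)]) -> good d D /\ tot A (d x).
Proof.
  intros H; split; [now apply good_app in H|]. apply (H x A w). apply in_app_iff; simpl; auto.
Qed.

Lemma linok_le d D : forall T T', linok d D T -> ele T' T -> linok d D T'.
Proof.
  destruct D as [|[[x A] w] D]; simpl; intros T T' H Hle.
  - intros v e. specialize (H v e); specialize (Hle v e); lia.
  - destruct H as (a & T1 & ? & ? & ?). exists a, T1; eauto using ele_trans.
Qed.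

Lemma linok_ext d d' D : forall T,
  (forall x, In x (names D) -> d x = d' x) -> linok d D T -> linok d' D T.
Proof.
  induction D as [|[[x A] w] D IH]; simpl; auto.
  intros T E (a & T' & H1 & H2 & H3). exists a, T'.
  rewrite <- E by (left; reflexivity).
  repeat split; auto.
Qed.

Lemma linok_app d D1 D2 : forall T1 T2,
  linok d D1 T1 -> linok d D2 T2 -> linok d (D1 ++ D2) (eadd T1 T2).
Proof.
  induction D1 as [|[[x A] w] D1 IH]; simpl; intros T1 T2 H1 H2.
  - eapply linok_le; [exact H2|]. intros v e. unfold eadd. rewrite H1. lia.
  - destruct H1 as (a & T3 & H3 & H4 & H5). exists a, (eadd T3 T2); repeat split; auto.
    ele_tac.
Qed.

Lemma linok_app_inv d D1 D2 : forall T, linok d (D1 ++ D2) T ->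
  exists T1 T2, linok d D1 T1 /\ linok d D2 T2 /\ ele T (eadd T1 T2).
Proof.
  induction D1 as [|[[x A] w] D1 IH]; simpl; intros T H.
  - exists (fun _ _ => 0), T; repeat split; auto. ele_tac.
  - destruct H as (a & T3 & H3 & H4 & H5). destruct (IH _ H4) as (T1 & T2 & H6 & H7 & H8).
    exists (eadd (one x (EM a)) T1), T2; repeat split; auto; [|ele_tac].
    exists a, T1; auto using ele_refl.
Qed.

Lemma linok_perm d D D' : Permutation D D' -> forall T, linok d D T -> linok d D' T.
Proof.
  induction 1 as [|[[x A] w] D D' _ IH|[[y B] w'] [[x A] w] D|]; simpl; auto.
  - intros T (a & T' & ? & ? & ?). exists a, T'; auto.
  - intros T (a & T' & H1 & (b & T2 & H2 & H3 & H4) & H5).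
    exists b, (eadd (one x (EM a)) T2); repeat split; auto; [|ele_tac].
    exists a, T2; auto using ele_refl.
Qed.

Lemma linok_out d D v e : ~ In v (names D) -> forall T, linok d D T -> T v e = 0.
Proof.
  induction D as [|[[x A] w] D IH]; simpl; intros Hv T H; auto.
  destruct H as (a & T' & _ & H1 & H2). specialize (IH ltac:(tauto) _ H1).
  specialize (H2 v e). env_simp; [tauto|lia].
Qed.

Lemma linok_inhabited d D : good d D -> exists T, linok d D T.
Proof.
  induction D as [|[[x A] w] D IH]; simpl; intros H.
  - exists (fun _ _ => 0); auto.
  - destruct IH as [T HT]; [intros y B w' Hin; eapply H; right; exact Hin|].
    destruct (tot_inhabited A (d x)) as [a Ha]; [eapply H; left; reflexivity|].
    exists (eadd (one x (EM a)) T), a, T; auto using ele_refl.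
Qed.

(** * Separating the uses of shared and linear channels *)

Definition calls_on (v : chan) (L : list (chan * pt)) : list pt :=
  map snd (filter (fun p => if Nat.eq_dec (fst p) v then true else false) L).

Lemma clients_cons a cs e : clients (a :: cs) e = unit_ent (EM a) e + clients cs e.
Proof. destruct e; simpl; units. Qed.

Lemma clients_one a e : clients [a] e = unit_ent (EM a) e.
Proof. rewrite clients_cons. destruct e; simpl; lia. Qed.

Lemma cenv_calls_on L v e : cenv L v e = clients (map PCall (calls_on v L)) e.
Proof.
  induction L as [|[u a] L IH].
  - destruct e; reflexivity.
  - change (cenv ((u, a) :: L)) with (eadd (one u (EM (PCall a))) (cenv L)).
    unfold eadd. rewrite IH. unfold calls_on. simpl.
    destruct (Nat.eq_dec u v) as [->|Hu]; [|unfold one, at_chan; destruct Nat.eq_dec; [congruence|auto]].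
    simpl map. rewrite clients_cons. env_simp; lia.
Qed.

Lemma in_calls_on v a L : In a (calls_on v L) -> In (v, a) L.
Proof.
  unfold calls_on. rewrite in_map_iff. intros ([u b] & <- & H).
  apply filter_In in H as [H E]. simpl in *. destruct Nat.eq_dec; [now subst|discriminate].
Qed.

Lemma cenv_app L1 L2 v e : cenv (L1 ++ L2) v e = cenv L1 v e + cenv L2 v e.
Proof. induction L1 as [|[u a] L1 IH]; simpl; auto. unfold eadd. lia. Qed.

Lemma callsok_zero g G : callsok g G (fun _ _ => 0).
Proof. exists []; split; [intros u a []|]. intros v e; simpl; lia. Qed.

Lemma callsok_add g G T1 T2 : callsok g G T1 -> callsok g G T2 -> callsok g G (eadd T1 T2).
Proof.
  intros (L1 & H1 & H2) (L2 & H3 & H4). exists (L1 ++ L2); split.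
  - intros u a Hin. apply in_app_iff in Hin as [?|?]; auto.
  - intros v e. rewrite cenv_app. spec v e. unfold eadd; lia.
Qed.

Lemma callsok_out g G T v e : callsok g G T -> ~ In v (names G) -> T v e = 0.
Proof.
  intros (L & H1 & H2) Hv. specialize (H2 v e). rewrite cenv_calls_on in H2.
  destruct (calls_on v L) as [|a l] eqn:E; [destruct e; simpl in H2; lia|].
  exfalso. apply Hv. apply (H1 v a). apply in_calls_on. rewrite E; simpl; auto.
Qed.

Lemma uses_out g d G D T v e : uses g d G D T -> ~ In v (names (G ++ D)) -> T v e = 0.
Proof.
  intros (T1 & T2 & H1 & H2 & H3) Hv. rewrite names_app, in_app_iff in Hv.
  specialize (H3 v e). unfold eadd in H3.
  rewrite (callsok_out _ _ _ v e H1), (linok_out d D v e ltac:(tauto) T2 H2) in H3; [lia|tauto].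
Qed.

Lemma uses_app g d G D1 D2 T1 T2 :
  uses g d G D1 T1 -> uses g d G D2 T2 -> uses g d G (D1 ++ D2) (eadd T1 T2).
Proof.
  intros (U1 & V1 & H1 & H2 & H3) (U2 & V2 & H4 & H5 & H6).
  exists (eadd U1 U2), (eadd V1 V2); repeat split;
    [now apply callsok_add | now apply linok_app | ele_tac].
Qed.

Lemma uses_snoc g d G D T x A w a :
  uses g d G D T -> d x a -> uses g d G (D ++ [(x, A, w)]) (eadd T (one x (EM a))).
Proof.
  intros H Ha. apply uses_app; auto.
  exists (fun _ _ => 0), (one x (EM a)); repeat split; auto using callsok_zero; [|ele_tac].
  exists a, (fun _ _ => 0); repeat split; auto. ele_tac.
Qed.

Lemma uses_snoc_inv g d G D T x A w : uses g d G (D ++ [(x, A, w)]) T ->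
  exists a T', d x a /\ uses g d G D T' /\ ele T (eadd T' (one x (EM a))).
Proof.
  intros (T1 & T2 & H1 & H2 & H3). apply linok_app_inv in H2 as (T3 & T4 & H4 & H5 & H6).
  destruct H5 as (a & T5 & H7 & H8 & H9).
  exists a, (eadd T1 T3); repeat split; auto.
  - exists T1, T3; auto using ele_refl.
  - simpl in H8. intros v e. specialize (H8 v e). spec v e. unfold eadd; lia.
Qed.

Lemma uses_ext g g' d d' G D T :
  (forall x, In x (names G) -> g x = g' x) -> (forall x, In x (names D) -> d x = d' x) ->
  uses g d G D T -> uses g' d' G D T.
Proof.
  intros Hg Hd (T1 & T2 & (L & H1 & H2) & H3 & H4). exists T1, T2; repeat split; auto.
  - exists L; split; auto. intros u a Hin. destruct (H1 _ _ Hin). rewrite <- Hg; auto.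
  - eapply linok_ext; eauto.
Qed.

Lemma uses_perm g d G G' D D' T : Permutation G G' -> Permutation D D' ->
  uses g d G D T -> uses g d G' D' T.
Proof.
  intros HG HD (T1 & T2 & (L & H1 & H2) & H3 & H4). exists T1, T2; repeat split; auto.
  - exists L; split; auto. intros u a Hin. destruct (H1 _ _ Hin). split; auto.
    eapply Permutation_in; [|eassumption]. now apply Permutation_map.
  - eapply linok_perm; eauto.
Qed.

Lemma uses_call g d G D T u a :
  uses g d G D T -> In u (names G) -> g u a -> uses g d G D (eadd T (one u (EM (PCall a)))).
Proof.
  intros (T1 & T2 & H1 & H2 & H3) Hu Ha. exists (eadd T1 (one u (EM (PCall a)))), T2.
  repeat split; auto; [|ele_tac]. apply callsok_add; auto.
  exists [(u, a)]; split; [intros ? ? [E|[]]; injection E as <- <-; auto|].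
  simpl. ele_tac.
Qed.

Lemma uses_calls_inv g d G D T u A w : ~ In u (names G) -> uses g d (G ++ [(u, A, w)]) D T ->
  exists us T', Forall (g u) us /\ uses g d G D T' /\ ele T (eadd T' (cl u (map PCall us))).
Proof.
  intros Hu (T1 & T2 & (L & H1 & H2) & H3 & H4).
  exists (calls_on u L), (eadd (clr u (cenv L)) T2); repeat split.
  - apply Forall_forall. intros a Ha. now apply H1, in_calls_on.
  - exists (clr u (cenv L)), T2; repeat split; auto using ele_refl.
    exists (filter (fun p => if Nat.eq_dec (fst p) u then false else true) L); split.
    + intros v a Hin. apply filter_In in Hin as [Hin E]. simpl in E.
      destruct (Nat.eq_dec v u); try discriminate. destruct (H1 _ _ Hin) as [H5 H6].
      split; auto. rewrite names_app, in_app_iff in H5. simpl in H5. intuition congruence.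
    + clear. intros v e. unfold clr. induction L as [|[v' a] L IH]; simpl; [destruct Nat.eq_dec; lia|].
      destruct (Nat.eq_dec v' u); simpl; unfold eadd; env_simp; lia.
  - intros v e. specialize (H2 v e); specialize (H4 v e). pose proof (cenv_calls_on L u e).
    unfold clr. env_simp; lia.
Qed.

Lemma uses_inhabited g d G D : good d D -> exists T, uses g d G D T.
Proof.
  intros H. destruct (linok_inhabited _ _ H) as [T HT].
  exists T, (fun _ _ => 0), T; repeat split; auto using callsok_zero. ele_tac.
Qed.

Lemma linok_valid D : forall T v, NoDup (names D) -> linok (fun _ a => a = PDag) D T ->
  forall e, T v e <= unit_ent (EM PDag) e.
Proof.
  induction D as [|[[x A] w] D IH]; simpl; intros T v Hnd HT e.
  - rewrite HT; lia.
  - apply NoDup_cons_iff in Hnd as [Hx Hnd].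
    destruct HT as (a & T' & -> & H1 & H2). specialize (H2 v e). specialize (IH T' v Hnd H1 e).
    pose proof (linok_out _ D x e Hx _ H1). env_simp; lia.
Qed.

(** When all free channels are answered by [PDag], each linear hypothesis has at most one client,
    each shared one has only calls, and only [z] has a provider. *)
Lemma uses_valid G D z c T : wf G D z ->
  uses (fun _ a => a = PDag) (fun _ a => a = PDag) G D T ->
  forall v, valid (eadd (one z (EP [c])) T v).
Proof.
  intros Hwf HT v. unfold wf in Hwf. apply NoDup_cons_iff in Hwf as [Hz Hnd].
  destruct (Nat.eq_dec v z) as [->|Hv].
  - eapply valid_le; [apply (valid_link c)|]. intros e.
    pose proof (uses_out _ _ _ _ _ z e HT Hz). env_simp; lia.
  - destruct HT as (T1 & T2 & H1 & H2 & H3). rewrite names_app in Hnd.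
    destruct (in_dec Nat.eq_dec v (names G)) as [Hin|Hin].
    (* With no provider on [v] the offer is free to choose: it consists of the calls actually
       made. *)
    + destruct H1 as (L & _ & H1). exists (map PCall (calls_on v L)); repeat split.
      * right. intros a Ha. apply in_map_iff in Ha as (b & <- & _). eauto.
      * intros a. specialize (H1 v (EM a)). specialize (H3 v (EM a)).
        rewrite cenv_calls_on in H1. simpl in H1.
        unfold eadd in H3. rewrite (linok_out _ D v _ (NoDup_app_disjoint _ _ _ _ Hnd Hin) T2 H2) in H3.
        env_simp; lia.
      * intros M. specialize (H1 v (EP M)). specialize (H3 v (EP M)).
        rewrite cenv_calls_on in H1. simpl in H1.
        unfold eadd in H3. rewrite (linok_out _ D v _ (NoDup_app_disjoint _ _ _ _ Hnd Hin) T2 H2) in H3.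
        env_simp; lia.
    + eapply valid_le; [apply (valid_link PDag)|]. intros e. specialize (H3 v e).
      pose proof (callsok_out _ _ _ v e H1 Hin).
      pose proof (linok_valid D T2 v (NoDup_app_remove_l _ _ Hnd) H2 e). env_simp; lia.
Qed.

(** * Adequacy *)

Lemma typed_wf Om G D P z A w : typed Om G D P z A w -> wf G D z.
Proof.
  induction 1; auto. unfold wf in *. eapply Permutation_NoDup; [|eassumption].
  apply perm_skip, Permutation_map. now apply Permutation_app.
Qed.

Lemma wf_snoc G D y A w z : wf G (D ++ [(y, A, w)]) z ->
  wf G D z /\ y <> z /\ ~ In y (names (G ++ D)).
Proof.
  unfold wf. rewrite app_assoc, names_app. simpl. intros H.
  change (z :: names (G ++ D) ++ [y]) with ((z :: names (G ++ D)) ++ [y]) in H.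
  pose proof (NoDup_remove _ _ _ H) as [H1 H2]. rewrite app_nil_r in H1, H2.
  simpl in H2. intuition congruence.
Qed.

Lemma wf_snoc_shared G D u A w z : wf (G ++ [(u, A, w)]) D z ->
  wf G D z /\ u <> z /\ ~ In u (names (G ++ D)).
Proof.
  intros H. apply (wf_snoc G D u A w z). unfold wf in *. eapply Permutation_NoDup; [|exact H].
  apply perm_skip, Permutation_map. rewrite <- app_assoc.
  apply Permutation_app_head, Permutation_app_comm.
Qed.

Lemma notin_app G D x : ~ In x (names (G ++ D)) -> ~ In x (names G) /\ ~ In x (names D).
Proof. rewrite names_app, in_app_iff. tauto. Qed.

(** [V] is what [Q] itself holds on [y] and [cs] what the receiver will do there; their coherence is
    what the restriction on [y] demands. *)
Lemma qt_send x y s a k cs Q V U T n :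
  qt Q U n -> ele U (eadd (eadd T (at_chan y V)) (one x (side s k))) ->
  (forall e, T y e = 0) -> x <> y -> valid (fun e => V e + clients cs e) ->
  a = PCom cs k ->
  kbind y valid (kact x (jout y (qt Q))) (eadd T (one x (side s a))) (S n).
Proof.
  intros HQ HU HT Hxy HV ->.
  exists (eadd (eadd (eadd T (at_chan y V)) (cl y cs)) (one x (side s (PCom cs k)))).
  repeat split.
  - right. exists s, (PCom cs k), k, (eadd (eadd T (at_chan y V)) (cl y cs)), (eadd U (cl y cs)), n.
    repeat split; auto using ele_refl; [|ele_tac].
    exists cs, U; repeat split; auto using ele_refl.
  - eapply valid_le; [exact HV|]. intros e. specialize (HT e). env_simp; lia.
  - intros v e Hv. env_simp; lia.
Qed.

Lemma qt_receive x y s a k cs Q U T n :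
  qt Q U n -> ele U (eadd (eadd T (one x (side s k))) (cl y cs)) ->
  (forall e, T y e = 0) -> x <> y -> a = PCom cs k ->
  kact x (jin y (qt Q)) (eadd T (one x (side s a))) (S n).
Proof.
  intros HQ HU HT Hxy ->.
  right. exists s, (PCom cs k), k, T, (eadd T (one x (side s k))), n.
  repeat split; auto using ele_refl.
  exists cs; split; auto. exists U; repeat split; auto.
  - intros e. specialize (HU y e). specialize (HT e). env_simp; lia.
  - intros v e Hv. specialize (HU v e). env_simp; lia.
Qed.

Lemma kbind_impl y B (K K' : quant) T n :
  (forall T n, K T n -> K' T n) -> kbind y B K T n -> kbind y B K' T n.
Proof. intros H (T' & ? & ? & ?). exists T'; auto. Qed.

Lemma valid_send a : valid (fun e => unit_ent (EP [a]) e + clients [a] e).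
Proof.
  eapply valid_le; [apply (valid_link a)|]. intros e. cbv beta. rewrite clients_one. lia.
Qed.

Lemma valid_serve aa : valid (fun e => unit_ent (EP (map PCall aa)) e + clients (map PCall aa) e).
Proof.
  exists (map PCall aa); repeat split.
  - right. intros a Ha. apply in_map_iff in Ha as (b & <- & _). eauto.
  - intros a. units.
  - intros M. units.
Qed.

(** Lets the last hypothesis range over any total set and exposes the point [a] at which it is used.
    Rules that bind or cut a linear name differ mainly in their choice of [S]. *)
Lemma sem_linear G D y A w P z C g d (S : points) :
  sem G (D ++ [(y, A, w)]) P z C -> ~ In y (names D) -> good g G -> good d D -> tot A S ->
  tot C (fun c => exists n T a, S a /\ uses g d G D T /\
    qt P (eadd (one z (EP [c])) (eadd T (one y (EM a)))) n).
Proof.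
  intros Hs Hy Hg Hd HS. eapply tot_mono; [|apply (Hs g (fupd d y S)); auto using good_fupd].
  intros c _ (n & T & HT & HP). apply uses_snoc_inv in HT as (a & T' & Ha & HT & Hle).
  rewrite fupd_eq in Ha. exists n, T', a; repeat split; auto.
  - eapply uses_ext; [reflexivity| |exact HT]. intros x Hx. apply fupd_neq. congruence.
  - eapply qt_mono; [exact HP|]. ele_tac.
Qed.

Lemma sem_shared G D u A w P z C g d (S : points) :
  sem (G ++ [(u, A, w)]) D P z C -> ~ In u (names G) -> good g G -> good d D -> tot A S ->
  tot C (fun c => exists n T us, Forall S us /\ uses g d G D T /\
    qt P (eadd (one z (EP [c])) (eadd T (cl u (map PCall us)))) n).
Proof.
  intros Hs Hy Hg Hd HS. eapply tot_mono; [|apply (Hs (fupd g u S) d); auto using good_fupd].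
  intros c _ (n & T & HT & HP). apply uses_calls_inv in HT as (us & T' & Ha & HT & Hle); auto.
  rewrite fupd_eq in Ha. exists n, T', us; repeat split; auto.
  - eapply uses_ext; [|reflexivity|exact HT]. intros x Hx. apply fupd_neq. congruence.
  - eapply qt_mono; [exact HP|]. ele_tac.
Qed.

(** A thread stuck on a silent provider is silent too: it does nothing further, so it may promise
    [PDag]. *)
Lemma provides_blocked g d G D x A w P z : good d D -> d x PDag ->
  (forall T, 1 <= T x (EM PDag) -> qt P T 0) ->
  provides P g d G (D ++ [(x, A, w)]) z PDag.
Proof.
  intros Hd Hx HP. destruct (uses_inhabited g d G D Hd) as [T HT].
  exists 0, (eadd T (one x (EM PDag))); split; [now apply uses_snoc|].
  apply HP. unfold eadd, one, at_chan. destruct (Nat.eq_dec x x); [|congruence]. units.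
Qed.

Lemma kact_blocked x J T : 1 <= T x (EM PDag) -> kact x J T 0.
Proof. left; auto. Qed.

Lemma nu_blocked x y J T : x <> y -> 1 <= T x (EM PDag) -> kbind y valid (kact x J) T 0.
Proof.
  intros Hxy H. exists (clr y T); repeat split.
  - left; split; auto. unfold clr. destruct Nat.eq_dec; congruence.
  - eapply valid_le; [apply valid_zero|]. intros e. unfold clr. destruct Nat.eq_dec; congruence || lia.
  - intros v e Hv. unfold clr. destruct Nat.eq_dec; lia.
Qed.

(** A server uses no linear hypotheses, and calls on shared ones can be added up freely, so any
    finite number of copies fits the same context. *)
Lemma copies_intro g d G x P (S : points) us : ~ In x (names G) ->
  (forall a, S a -> exists n T, uses g d G [] T /\ qt P (eadd (one x (EP [a])) T) n) ->
  Forall S us ->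
  exists T n, uses g d G [] T /\
    copies (fun a => kbind x (atmost (unit_ent (EP [a]))) (qt P)) us T n.
Proof.
  intros Hx HS Hus. induction Hus as [|a us Ha Hus (T & n & HT & Hc)]; simpl.
  - destruct (uses_inhabited g d G []) as [T HT]; [intros ? ? ? []|]. eauto.
  - destruct (HS a Ha) as (m & U & HU & HP).
    exists (eadd U T), (m + n); split; [now apply (uses_app g d G [] [])|].
    exists U, m, T, n; repeat split; auto using ele_refl.
    exists (eadd (one x (EP [a])) U); repeat split; auto.
    + intros e. pose proof (uses_out _ _ _ _ _ x e HU ltac:(now rewrite app_nil_r)).
      env_simp; lia.
    + intros v e Hv. env_simp; lia.
Qed.

Lemma valid_nu_link U a : (forall e, U e <= unit_ent (EP [a]) e + unit_ent (EM a) e) -> valid U.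
Proof. intros H. eapply valid_le; [apply (valid_link a)|]. intros e. specialize (H e). cbv beta; lia. Qed.

Lemma NoDup_fst (A : Type) (bs : list (label * A)) l P Q :
  NoDup (map fst bs) -> In (l, P) bs -> In (l, Q) bs -> P = Q.
Proof.
  induction bs as [|[l' R] bs IH]; simpl; [tauto|]. rewrite NoDup_cons_iff.
  intros [H1 H2] [E1|H3] [E2|H4]; auto; try congruence; exfalso; apply H1.
  - injection E1 as -> ->. apply (in_map fst _ _ H4).
  - injection E2 as -> ->. apply (in_map fst _ _ H3).
Qed.

Lemma same_labels (A B : Type) (bs : list (label * A)) (ts : list (label * B)) l b :
  Permutation (map fst bs) (map fst ts) -> In (l, b) ts -> exists a, In (l, a) bs.
Proof.
  intros Hp Hin. apply (in_map fst) in Hin. simpl in Hin.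
  apply (Permutation_in _ (Permutation_sym Hp)), in_map_iff in Hin as ([l' a] & <- & H). eauto.
Qed.

Lemma fresh_label (l : list label) : exists k, ~ In k l.
Proof.
  exists (S (list_max l)). intros H.
  pose proof (proj1 (list_max_le l (list_max l)) (le_n _)) as HF.
  rewrite Forall_forall in HF. specialize (HF _ H). lia.
Qed.

Lemma tot_with_incl ts ts' S :
  (forall p, In p ts -> In p ts') -> tot (TWith ts') S -> tot (TWith ts) S.
Proof.
  intros Hin [H|[H1 H2]]; [left; auto|right]. split; auto. intros l X HX. apply H2.
  apply in_tot in HX as (A & HA & ->). apply in_tot; eauto.
Qed.

Lemma tot_plus_incl ts ts' S :
  (forall p, In p ts -> In p ts') -> tot (TPlus ts) S -> tot (TPlus ts') S.
Proof.
  intros Hin [H|(l & X & S1 & HX & H)]; [left; auto|right]. exists l, X, S1; split; auto.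
  apply in_tot in HX as (A & HA & ->). apply in_tot; eauto.
Qed.

Lemma select_intro x l s k Q T n :
  qt Q (eadd T (one x (side s k))) n ->
  qt (PSel x l Q) (eadd T (one x (side s (PLab l k)))) (S n).
Proof.
  intros H. right. exists s, (PLab l k), k, T, (eadd T (one x (side s k))), n.
  repeat split; auto using ele_refl. eexists; eauto using ele_refl.
Qed.

Lemma case_intro x l s k bs T n :
  (forall Q, In (l, Q) bs -> qt Q (eadd T (one x (side s k))) n) ->
  qt (PCase x bs) (eadd T (one x (side s (PLab l k)))) (S n).
Proof.
  intros H. right. exists s, (PLab l k), k, T, (eadd T (one x (side s k))), n.
  repeat split; auto using ele_refl. exists l; split; auto.
  intros K HK. apply in_map_iff in HK as ([l' Q] & E & HQ). injection E as <- <-.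
  eexists; eauto using ele_refl.
Qed.

Lemma prefix_domain_out x w Q T n : qt Q T n -> qt (POutD x w Q) T (S n).
Proof. intros H. exists T, n; auto using ele_refl. Qed.

Lemma prefix_domain_in x a Q T n : qt Q T n -> qt (PInD x a Q) T (S n).
Proof. intros H. exists T, n; auto using ele_refl. Qed.

(** The common form of left rules that keep the name [x], at most changing the point used there. *)
Lemma sem_left G D x A A' w P P' z C g d (S : points) :
  sem G (D ++ [(x, A', w)]) P z C -> wf G (D ++ [(x, A, w)]) z ->
  good g G -> good d (D ++ [(x, A, w)]) -> tot A' S ->
  (forall T a n, S a -> qt P (eadd T (one x (EM a))) n ->
     exists a' n', d x a' /\ qt P' (eadd T (one x (EM a'))) n') ->
  tot C (provides P' g d G (D ++ [(x, A, w)]) z).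
Proof.
  intros Hs Hwf Hg Hd HS H. destruct (wf_snoc _ _ _ _ _ _ Hwf) as (_ & _ & Hx).
  apply notin_app in Hx as [_ Hx]. apply good_last in Hd as [Hd _].
  eapply tot_mono; [|apply (sem_linear _ _ _ _ _ _ _ _ g d S Hs); auto].
  intros c _ (n & T & a & Ha & HT & HP).
  destruct (H (eadd (one z (EP [c])) T) a n Ha) as (a' & n' & Ha' & HP').
  - eapply qt_mono; [exact HP|]. ele_tac.
  - exists n', (eadd T (one x (EM a'))); split; [now apply uses_snoc|].
    eapply qt_mono; [exact HP'|]. ele_tac.
Qed.

(** Left rules for communicating types split on whether [d x] contains [PDag]. If so, the process is
    blocked and answers [PDag]; otherwise totality of [d x] supplies the points for the
    continuation. *)
Theorem adequacy Om G D P z A w : typed Om G D P z A w -> sem G D P z A.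
Proof.
  induction 1; intros g d Hg Hd.
  - apply (tot_mono A (d x)).
    + intros a Ha HS. exists 1, (eadd (fun _ _ => 0) (one x (EM a))); split.
      * apply (uses_snoc g d G []); auto. exists (fun _ _ => 0), (fun _ _ => 0).
        repeat split; auto using callsok_zero. ele_tac.
      * exists false, a; repeat split; auto. simpl. ele_tac.
    + apply (Hd x A w). left; auto.
  - right. destruct (uses_inhabited g d G [] Hd) as [T HT]. exists 0, T; split; simpl; auto.
  - destruct (wf_snoc _ _ _ _ _ _ H) as (_ & _ & Hx).
    destruct (good_last _ _ _ _ _ Hd) as [Hd' Hx'].
    (* [P] does not mention [x], yet the extended context must assign it a point. *)
    destruct (tot_inhabited _ _ Hx') as [a Ha].
    eapply tot_mono; [|apply (IHtyped g d Hg Hd')].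
    intros c _ (n & T & HT & HP). exists n, (eadd T (one x (EM a))); split; [now apply uses_snoc|].
    eapply qt_mono; [exact HP|]. ele_tac.
  - destruct (wf_snoc _ _ _ _ _ _ (typed_wf _ _ _ _ _ _ _ H0)) as (_ & Hyz & Hy).
    right. intros S1 HS1.
    eapply tot_mono; [|apply (sem_linear _ _ _ _ _ _ _ _ g d S1 IHtyped); auto; apply notin_app in Hy; tauto].
    intros c _ (n & T & a & Ha & HT & HP). exists a; split; auto.
    exists (S n), T; split; auto.
    eapply qt_mono; [eapply (qt_receive z y true _ c [a] P _ T); [exact HP| | |auto|reflexivity]|].
    + intros v e. pose proof (clients_one a e). simpl side. env_simp; lia.
    + intros e. eapply uses_out; eauto.
    + simpl side. ele_tac.
  - rewrite app_assoc in *.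
    destruct (wf_snoc _ _ _ _ _ _ H) as (Hwf & Hxz & Hx).
    destruct (good_last _ _ _ _ _ Hd) as [Hd' Hx'].
    destruct (good_app _ _ _ Hd') as [Hd1 Hd2].
    unfold freshc in H0. rewrite app_assoc in H0. rewrite names_app in H0. simpl in H0.
    rewrite in_app_iff in H0. simpl in H0.
    assert (Hxy : x <> y) by (intros ->; tauto).
    destruct Hx' as [Hx'|Hx'].
    { apply tot_dag, provides_blocked; auto. intros T HT.
      eapply kbind_impl; [|apply (nu_blocked x y (jout y (qt (PPar P Q))) T Hxy HT)].
      intros; left; auto. }
    pose proof (IHtyped1 g d Hg Hd1) as HP.
    (* The function on [x] is applied to everything [P] provides on [y]; [Q] continues on [x] with
       the results. *)
    eapply tot_mono; [|apply (sem_linear _ _ _ _ _ _ _ _ g d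
      (fun b => exists a, provides P g d G D1 y a /\ d x (PCom [a] b)) IHtyped2); auto;
      destruct (notin_app _ _ _ Hx) as [_ Hx2]; rewrite names_app, in_app_iff in Hx2; tauto].
    intros c _ (n & T & b & (a & (n1 & T1 & HT1 & HP1) & Hb) & HT & HQ).
    exists (S (n1 + n)), (eadd (eadd T1 T) (one x (EM (PCom [a] b)))); split.
    { apply uses_snoc; auto. now apply uses_app. }
    rewrite !names_app, !in_app_iff in H0.
    eapply qt_mono; [eapply kbind_impl; [intros T' n' HK; left; exact HK|]|].
    + eapply (qt_send x y false _ b [a] (PPar P Q) (unit_ent (EP [a]))
        (eadd (eadd (one y (EP [a])) T1) (eadd (one z (EP [c])) (eadd T (one x (EM b)))))
        (eadd (one z (EP [c])) (eadd T1 T))); auto using valid_send.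
      * exists (eadd (one y (EP [a])) T1), n1, (eadd (one z (EP [c])) (eadd T (one x (EM b)))), n.
        repeat split; auto using ele_refl.
      * unfold one at 1. simpl side. ele_tac.
      * intros e. pose proof (uses_out _ _ _ _ _ y e HT1). pose proof (uses_out _ _ _ _ _ y e HT).
        rewrite !names_app, !in_app_iff in *.
        unfold eadd, one, at_chan. destruct Nat.eq_dec; [subst; tauto|]. rewrite H3, H4; tauto.
    + simpl side. ele_tac.
  - destruct (good_app _ _ _ Hd) as [Hd1 Hd2]. unfold freshc in H0.
    right. exists (provides P g d G D1 y), (provides Q g d G D2 z); repeat split; auto.
    intros a b (n1 & T1 & HT1 & HP) (n & T & HT & HQ).
    exists (S (n1 + n)), (eadd T1 T); split; [now apply uses_app|].
    assert (Hzy : z <> y) by (intros ->; simpl in H0; tauto).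
    eapply qt_mono; [eapply kbind_impl; [intros T' n' HK; left; exact HK|]|].
    + eapply (qt_send z y true _ b [a] (PPar P Q) (unit_ent (EP [a]))
        (eadd (eadd (one y (EP [a])) T1) (eadd (one z (EP [b])) T))
        (eadd T1 T)); auto using valid_send.
      * exists (eadd (one y (EP [a])) T1), n1, (eadd (one z (EP [b])) T), n.
        repeat split; auto using ele_refl.
      * unfold one at 1. simpl side. ele_tac.
      * intros e. pose proof (uses_out _ _ _ _ _ y e HT1). pose proof (uses_out _ _ _ _ _ y e HT).
        simpl in H0. rewrite !names_app, !in_app_iff in *. unfold eadd. rewrite H3, H4; tauto.
    + simpl side. ele_tac.
  - pose proof (typed_wf _ _ _ _ _ _ _ H0) as Hwf.
    change [(y, A, w2); (x, B, w2)] with ([(y, A, w2)] ++ [(x, B, w2)]) in *.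
    rewrite app_assoc in *.
    destruct (wf_snoc _ _ _ _ _ _ Hwf) as (Hwf' & _ & Hx).
    destruct (wf_snoc _ _ _ _ _ _ Hwf') as (_ & Hyz & Hy).
    destruct (good_last _ _ _ _ _ Hd) as [Hd' Hx'].
    destruct Hx' as [Hx'|(S1 & S2 & HS1 & HS2 & Hc)].
    { apply tot_dag, provides_blocked; auto. intros T HT. now apply kact_blocked. }
    assert (Hxy : x <> y).
    { intros ->. apply Hx. rewrite app_assoc, names_app, in_app_iff. right; left; auto. }
    destruct (notin_app _ _ _ Hx) as [_ HxD], (notin_app _ _ _ Hy) as [_ HyD].
    (* [y] and [x] are answered independently from [S1] and [S2]; every resulting pair lies in
       [d x]. *)
    eapply tot_mono; [|apply (sem_linear _ _ _ _ _ _ _ _ g (fupd d y S1) S2 IHtyped);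
                       auto using good_fupd].
    intros c _ (n & T & b & Hb & HT & HP).
    apply uses_snoc_inv in HT as (a & T' & Ha & HT & Hle). rewrite fupd_eq in Ha.
    assert (HT' : uses g d G D T').
    { eapply uses_ext; [reflexivity| |exact HT]. intros v Hv. apply fupd_neq. congruence. }
    exists (S n), (eadd T' (one x (EM (PCom [a] b)))); split; [now apply uses_snoc; auto|].
    eapply qt_mono; [apply (qt_receive x y false (PCom [a] b) b [a] P _ (eadd (one z (EP [c])) T') n HP); auto|].
    + intros v e. pose proof (clients_one a e). specialize (Hle v e). simpl side. env_simp; lia.
    + intros e. pose proof (uses_out _ _ _ _ _ y e HT' Hy). env_simp; lia.
    + simpl side. ele_tac.
  - right. split.
    (* A label outside [bs] selects no branch, so the process answers it vacuously; this gives an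
       element even when there are no branches. *)
    + destruct (fresh_label (map fst bs)) as [k Hk]. exists k, PNil.
      destruct (uses_inhabited g d G D Hd) as [T HT]. exists 1, T; split; auto.
      eapply qt_mono; [apply (case_intro z k true PNil bs T 0)|simpl side; ele_tac].
      intros Q HQ. exfalso. apply Hk. apply (in_map fst _ _ HQ).
    + intros l X HX. apply in_tot in HX as (A & HA & ->).
      destruct (same_labels _ _ _ _ _ _ H2 HA) as [P HP].
      eapply tot_mono; [|apply (H4 l P A HP HA g d Hg Hd)].
      intros a _ (n & T & HT & HQ). exists (S n), T; split; auto.
      eapply qt_mono; [apply (case_intro z l true a bs T n)|simpl side; ele_tac].
      intros Q HQ'. rewrite <- (NoDup_fst _ _ _ _ _ H0 HP HQ').
      eapply qt_mono; [exact HQ|]. simpl side. ele_tac.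
  - destruct (good_last _ _ _ _ _ Hd) as [Hd' [Hx'|[_ Hx']]].
    { apply tot_dag, provides_blocked; auto. intros T HT. now apply kact_blocked. }
    apply (sem_left _ _ _ _ _ _ P _ _ _ g d (fun a => d x (PLab l a)) IHtyped); auto.
    + apply (Hx' l). left; auto.
    + intros T a n Ha HP. exists (PLab l a), (S n); split; auto.
      now apply (select_intro x l false).
  - destruct (good_last _ _ _ _ _ Hd) as [Hd' Hx'].
    apply (sem_left _ _ _ _ _ _ P _ _ _ g d (d x) IHtyped); eauto.
    eapply tot_with_incl; [|exact Hx']. intros p Hp.
    eapply Permutation_in; [apply Permutation_sym; eassumption|right; auto].
  - right. exists l, (tot A), (provides P g d G D z); repeat split; auto; [left; auto|].
    intros a (n & T & HT & HP). exists (S n), T; split; auto.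
    eapply qt_mono; [apply (select_intro z l true a P T n)|simpl side; ele_tac].
    eapply qt_mono; [exact HP|]. simpl side. ele_tac.
  - apply (tot_plus_incl ts); auto. intros p Hp.
    eapply Permutation_in; [apply Permutation_sym; eassumption|right; auto].
  - destruct (good_last _ _ _ _ _ Hd) as [Hd' [Hx'|(l & X & S1 & HX & HS & Hx')]].
    { apply tot_dag, provides_blocked; auto. intros T HT. now apply kact_blocked. }
    apply in_tot in HX as (A & HA & ->). destruct (same_labels _ _ _ _ _ _ H2 HA) as [Q HQ].
    apply (sem_left _ _ _ _ _ _ Q _ _ _ g d S1 (H4 l Q A HQ HA)); auto.
    intros T a n Ha HP. exists (PLab l a), (S n); split; auto.
    apply (case_intro x l false). intros Q' HQ'.
    now rewrite <- (NoDup_fst _ _ _ _ _ H0 HQ HQ').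
  - assert (Hy : ~ In y (names G)).
    { pose proof (typed_wf _ _ _ _ _ _ _ H1) as Hwf. unfold wf in Hwf. rewrite app_nil_r in Hwf.
      now apply NoDup_cons_iff in Hwf. }
    right. exists (provides Q g d G [] y); split; auto. intros aa Haa.
    destruct (copies_intro g d G y Q (provides Q g d G [] y) aa Hy (fun a H => H) Haa)
      as (T & n & HT & Hc).
    exists (S n), T; split; auto. simpl in H0.
    eapply qt_mono; [eapply kbind_impl; [intros T' n' HK; left; exact HK|]|].
    + eapply (qt_send z u true _ PNil (map PCall aa) (PRep u y Q) (unit_ent (EP (map PCall aa)))
        (eadd T (one u (EP (map PCall aa)))) T); auto using valid_serve.
      * exists aa, T; auto using ele_refl.
      * unfold one at 1. ele_tac.
      * intros e. apply (uses_out _ _ _ _ _ u e HT). rewrite app_nil_r. tauto.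
    + simpl side. ele_tac.
  - pose proof (typed_wf _ _ _ _ _ _ _ H1) as Hwf.
    destruct (wf_snoc_shared _ _ _ _ _ _ Hwf) as (_ & Huz & Hu).
    destruct (good_last _ _ _ _ _ Hd) as [Hd' [Hx'|(S1 & HS & Hx')]].
    { apply tot_dag, provides_blocked; auto. intros T HT. now apply kact_blocked. }
    destruct (notin_app _ _ _ Hu) as [HuG _].
    eapply tot_mono; [|apply (sem_shared _ _ _ _ _ _ _ _ g d S1 IHtyped); auto].
    intros c _ (n & T & us & Hus & HT & HP).
    exists (S n), (eadd T (one x (EM (PCom (map PCall us) PNil)))); split; [apply uses_snoc; auto|].
    eapply qt_mono; [apply (qt_receive x u false (PCom (map PCall us) PNil) PNil (map PCall us) P _
      (eadd (one z (EP [c])) T) n HP); auto|].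
    + simpl side. ele_tac.
    + intros e. pose proof (uses_out _ _ _ _ _ u e HT Hu). env_simp; lia.
    + simpl side. ele_tac.
  - pose proof (typed_wf _ _ _ _ _ _ _ H1) as Hwf.
    destruct (wf_snoc _ _ _ _ _ _ Hwf) as (_ & Hyz & Hy).
    destruct (good_last _ _ _ _ _ Hg) as [_ Hu].
    assert (Hin : In u (names (G ++ [(u, A, w2)]))).
    { rewrite names_app, in_app_iff. right; left; auto. }
    assert (Hyu : y <> u).
    { intros ->. apply Hy. rewrite names_app, in_app_iff. auto. }
    destruct (notin_app _ _ _ Hy) as [_ HyD].
    (* The linear copy [y] is answered from the set of [u] itself, and its point is then recorded as
       one more call on [u]. *)
    eapply tot_mono; [|apply (sem_linear _ _ _ _ _ _ _ _ g d (g u) IHtyped); auto].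
    intros c _ (n & T & a & Ha & HT & HP).
    exists (S n), (eadd T (one u (EM (PCall a)))); split; [now apply uses_call|].
    exists (eadd (eadd (one z (EP [c])) (eadd T (one y (EM a))))
              (eadd (one u (EM (PCall a))) (one y (EP [a])))); repeat split.
    + right. exists a; eexists; exists n; repeat split; [exact HP|]. ele_tac.
    + apply (valid_nu_link _ a). intros e. pose proof (uses_out _ _ _ _ _ y e HT Hy).
      env_simp; lia.
    + intros v e Hv. env_simp; lia.
  - pose proof (typed_wf _ _ _ _ _ _ _ H2) as Hwf1. pose proof (typed_wf _ _ _ _ _ _ _ H3) as Hwf2.
    destruct (wf_snoc _ _ _ _ _ _ Hwf2) as (_ & Hxz & Hx2).
    apply NoDup_cons_iff in Hwf1 as [Hx1 _].
    destruct (good_app _ _ _ Hd) as [Hd1 Hd2]. destruct (notin_app _ _ _ Hx2) as [_ HxD].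
    (* What [P] provides becomes the total set for [x] in [Q]; both then meet at one point [a],
       which makes the new [x] coherent. *)
    eapply tot_mono; [|apply (sem_linear _ _ _ _ _ _ _ _ g d _ IHtyped2 HxD Hg Hd2
                               (IHtyped1 g d Hg Hd1))].
    intros c _ (n & T & a & (n1 & T1 & HT1 & HP) & HT & HQ).
    exists (n1 + n), (eadd T1 T); split; [now apply uses_app|].
    exists (eadd (eadd (one x (EP [a])) T1) (eadd (one z (EP [c])) (eadd T (one x (EM a)))));
      repeat split.
    + do 4 eexists; repeat split; [exact HP | exact HQ | apply ele_refl].
    + apply (valid_nu_link _ a). intros e. pose proof (uses_out _ _ _ _ _ x e HT Hx2).
      pose proof (uses_out _ _ _ _ _ x e HT1 Hx1). env_simp; lia.
    + intros v e Hv. env_simp; lia.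
  - pose proof (typed_wf _ _ _ _ _ _ _ H1) as Hwf1. pose proof (typed_wf _ _ _ _ _ _ _ H2) as Hwf2.
    destruct (wf_snoc_shared _ _ _ _ _ _ Hwf2) as (_ & Huz & Hu).
    apply NoDup_cons_iff in Hwf1 as [Hx1 _]. rewrite app_nil_r in Hx1.
    destruct (notin_app _ _ _ Hu) as [HuG _].
    assert (Hd0 : good d []) by (intros ? ? ? []).
    eapply tot_mono; [|apply (sem_shared _ _ _ _ _ _ _ _ g d _ IHtyped2 HuG Hg Hd
                               (IHtyped1 g d Hg Hd0))].
    intros c _ (n & T & us & Hus & HT & HQ).
    (* The calls [us] made by [Q] are known first and determine how many copies of [P] to
       assemble. *)
    destruct (copies_intro g d G x P (provides P g d G [] x) us Hx1 (fun a H => H) Hus)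
      as (T1 & n1 & HT1 & Hc).
    exists (n1 + n), (eadd T1 T); split; [now apply (uses_app g d G [] D)|].
    exists (eadd (eadd T1 (one u (EP (map PCall us))))
              (eadd (one z (EP [c])) (eadd T (cl u (map PCall us))))); repeat split.
    + do 4 eexists; repeat split; [|exact HQ|apply ele_refl].
      exists us, T1; auto using ele_refl.
    + eapply valid_le; [apply (valid_serve us)|]. intros e.
      pose proof (uses_out _ _ _ _ _ u e HT Hu).
      pose proof (uses_out _ _ _ _ _ u e HT1 ltac:(now rewrite app_nil_r)). env_simp; lia.
    + intros v e Hv. env_simp; lia.
  - pose proof (typed_wf _ _ _ _ _ _ _ H3) as Hwf. apply NoDup_cons_iff in Hwf as [Hy _].
    right. exists (provides P g d G D y); split; auto. intros a (n & T & HT & HP).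
    exists (S n), T; split; auto.
    eapply qt_mono.
    + eapply (qt_send z y true _ PNil [a] P (unit_ent (EP [a])) (eadd (one y (EP [a])) T) T);
        auto using valid_send.
      * unfold one at 1. ele_tac.
      * intros e. apply (uses_out _ _ _ _ _ y e HT Hy).
    + simpl side. ele_tac.
  - pose proof (typed_wf _ _ _ _ _ _ _ H1) as Hwf.
    destruct (wf_snoc _ _ _ _ _ _ Hwf) as (_ & Hyz & Hy).
    destruct (good_last _ _ _ _ _ Hd) as [Hd' [Hx'|(S1 & HS & Hx')]].
    { apply tot_dag, provides_blocked; auto. intros T HT. now apply kact_blocked. }
    destruct (notin_app _ _ _ Hy) as [_ HyD].
    eapply tot_mono; [|apply (sem_linear _ _ _ _ _ _ _ _ g d S1 IHtyped); auto].
    intros c _ (n & T & a & Ha & HT & HP).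
    exists (S n), (eadd T (one x (EM (PCom [a] PNil)))); split; [apply uses_snoc; auto|].
    eapply qt_mono; [apply (qt_receive x y false (PCom [a] PNil) PNil [a] P _ (eadd (one z (EP [c])) T) n HP); auto|].
    + intros v e. pose proof (clients_one a e). simpl side. env_simp; lia.
    + intros e. pose proof (uses_out _ _ _ _ _ y e HT Hy). env_simp; lia.
    + simpl side. ele_tac.
  - right. pose proof (IHtyped g d Hg Hd) as HS. rewrite tot_tinst in HS.
    eapply tot_mono; [|exact HS]. intros c _ (n & T & HT & HP).
    exists (S n), T; split; auto. now apply prefix_domain_in.
  - destruct (good_last _ _ _ _ _ Hd) as [Hd' Hx'].
    apply (sem_left _ _ _ _ _ _ Q _ _ _ g d (d x) IHtyped); auto.
    + rewrite tot_tinst. destruct Hx' as [Hx'|Hx']; auto using tot_dag.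
    + intros T a n Ha HP. exists a, (S n); split; auto. now apply prefix_domain_out.
  - right. pose proof (IHtyped g d Hg Hd) as HS. rewrite tot_tinst in HS.
    eapply tot_mono; [|exact HS]. intros c _ (n & T & HT & HP).
    exists (S n), T; split; auto. now apply prefix_domain_out.
  - destruct (good_last _ _ _ _ _ Hd) as [Hd' Hx'].
    apply (sem_left _ _ _ _ _ _ Q _ _ _ g d (d x) IHtyped); auto.
    + rewrite tot_tinst. destruct Hx' as [Hx'|Hx']; auto using tot_dag.
    + intros T a' n Ha HP. exists a', (S n); split; auto. now apply prefix_domain_in.
  - right. rewrite <- (tot_tinst A w). now apply IHtyped.
  - destruct (good_last _ _ _ _ _ Hd) as [Hd' Hx'].
    apply (sem_left _ _ _ _ _ _ P _ _ _ g d (d x) IHtyped); eauto.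
    rewrite tot_tinst. destruct Hx' as [Hx'|Hx']; auto using tot_dag.
  - eapply tot_mono; [|apply (IHtyped g d)].
    + intros c _ (n & T & HT & HP). exists n, T; split; auto. eapply uses_perm; eauto.
    + intros x B w' Hin. apply (Hg x B w'). eapply Permutation_in; eauto.
    + intros x B w' Hin. apply (Hd x B w'). eapply Permutation_in; eauto.
  - eapply tot_mono; [|apply (IHtyped g d Hg Hd)]. intros c _ (n & T & HT & HP).
    exists n, T; split; auto. now rewrite (qt_scong _ _ H).
Qed.

Theorem theorem6 (Om : accenv) (G D : ctx) (P : proc) (x : chan) (A : ty) (w : dom) :
  typed Om G D P x A w -> terminates P.
Proof.
  intros H.
  (* All free channels are taken silent; inhabitation then turns totality into an actual
     approximant. *)
  destruct (tot_inhabited A _ (adequacy _ _ _ _ _ _ _ H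
    (fun _ a => a = PDag) (fun _ a => a = PDag)
    (fun _ _ _ _ => tot_dag _ _ eq_refl) (fun _ _ _ _ => tot_dag _ _ eq_refl)))
    as (c & n & T & HT & HP).
  apply (qt_terminates _ _ _ HP). eapply uses_valid; [eapply typed_wf; exact H | exact HT].
Qed.
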